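(* There exist a constant $c>0$ and a polynomial-time algorithm for the graph isomorphism problem on bipartite graphs on $n+n$ vertices after excluding at most $2\exp(-n^{c})\,2^{n^2}$ graphs; that is, for each $n$ there is a set of at most $2\exp(-n^c)2^{n^2}$ bipartite graphs on $n+n$ vertices such that the algorithm runs in time polynomial in $n$ and correctly decides whether $G$ and $G'$ are isomorphic for all bipartite graphs $G,G'$ on $n+n$ vertices not in this set. Phrased probabilistically, there exists a polynomial-time algorithm that resolves the graph isomorphism problem on two uniformly sampled bipartite graphs on $n+n$ vertices and that succeeds with probability at least $1-2\exp(-n^{c})$.
   Context: A bipartite graph on $n+n$ vertices is a simple graph with two fixed labelled vertex classes of size $n$ each, all of whose edges join the two classes; there are $2^{n^2}$ such graphs. The graph isomorphism problem (GI) asks, given two graphs $G,G'$, whether they are isomorphic. *)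

(* Defs.v *)
From HB Require Import structures.
From mathcomp Require Import all_boot all_order all_algebra all_fingroup.
From mathcomp Require Import all_classical all_reals all_analysis.
Set Implicit Arguments.
Unset Strict Implicit.
Unset Printing Implicit Defensive.
Import GRing.Theory.

(* [(i, j) \in G] means that vertex [i] of the first class is joined to vertex
   [j] of the second class; see [adj] for the graph on the [2n] vertices. *)
Definition bigraph (n : nat) : finType := {set 'I_n * 'I_n}.

Definition vertex (n : nat) : finType := ('I_n + 'I_n)%type.

Definition adj (n : nat) (G : bigraph n) : rel (vertex n) :=
  fun u v => match u, v with
             | inl i, inr j => (i, j) \in (G : {set _})
             | inr j, inl i => (i, j) \in (G : {set _})
             | _, _ => false
             end.

Lemma card_bigraph n : #|bigraph n| = 2 ^ (n ^ 2).
Proof.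
have -> : n ^ 2 = #|[set: 'I_n * 'I_n]| by rewrite cardsT card_prod card_ord.
by rewrite -card_powerset powersetT cardsT.
Qed.

Lemma adj_simple n (G : bigraph n) : symmetric (adj G) /\ irreflexive (adj G).
Proof. by split=> [[i|i] [j|j]|[i|i]]. Qed.

Lemma adj_onto n (e : rel (vertex n)) :
  symmetric e ->
  (forall i j : 'I_n, ~~ e (inl i) (inl j) /\ ~~ e (inr i) (inr j)) ->
  exists! G : bigraph n, adj G =2 e.
Proof.
move=> sym_e bip_e; exists [set p | e (inl p.1) (inr p.2)]; split.
  move=> [i|i] [j|j] /=; rewrite ?inE //=.
  - by case: (bip_e i j) => /negPf->.
  - by case: (bip_e i j) => _ /negPf->.
move=> G adjG; apply/setP => -[i j]; rewrite inE /=.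
by rewrite -adjG.
Qed.

(* Isomorphism of the underlying graphs: the bijection is not required to
   preserve, or even to respect, the two classes. *)
Definition isomorphic (n : nat) (G G' : bigraph n) : bool :=
  [exists s : {perm vertex n},
    [forall u, forall v, adj G' (s u) (s v) == adj G u v]].

(* The random access machines of Cook and Reckhow (Time bounded random access
   machines, JCSS 7, 1973), on natural numbers. Arithmetic is restricted to
   addition and truncated subtraction, so that [t] steps lengthen the contents
   of registers by at most [t] bits beyond the constants of the program and
   the numbers in the input: polynomial time for the unit cost measure used
   here is therefore the same as polynomial time on Turing machines. *)
Inductive instr : Type :=
| Const of nat & nat        (* Const i a:   X_i := a *)
| Add of nat & nat & nat    (* Add i j k:   X_i := X_j + X_k *)
| Sub of nat & nat & nat    (* Sub i j k:   X_i := X_j - X_k *)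
| Fetch of nat & nat        (* Fetch i j:   X_i := X_(X_j) *)
| Store of nat & nat        (* Store i j:   X_(X_i) := X_j *)
| JumpPos of nat & nat      (* JumpPos i m: if X_i > 0 then go to m *)
| Read of nat.              (* Read i:      X_i := next input, 0 if none *)

Definition program := seq instr.

Record config := Config { pc : nat; reg : nat -> nat; input : seq nat }.

Definition upd (r : nat -> nat) (i a : nat) : nat -> nat :=
  fun j => if j == i then a else r j.

Definition exec (ins : instr) (C : config) : config :=
  let: Config q r w := C in
  match ins with
  | Const i a => Config q.+1 (upd r i a) w
  | Add i j k => Config q.+1 (upd r i (r j + r k)) w
  | Sub i j k => Config q.+1 (upd r i (r j - r k)) w
  | Fetch i j => Config q.+1 (upd r i (r (r j))) w
  | Store i j => Config q.+1 (upd r (r i) (r j)) w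
  | JumpPos i m => Config (if 0 < r i then m else q.+1) r w
  | Read i => Config q.+1 (upd r i (head 0 w)) (behead w)
  end.

Definition halted (P : program) (C : config) : bool := size P <= pc C.

Definition step (P : program) (C : config) : config :=
  if onth P (pc C) is Some ins then exec ins C else C.

Definition run (P : program) (w : seq nat) (t : nat) : config :=
  iter t (step P) (Config 0 (fun=> 0) w).

Definition halts_within (P : program) (w : seq nat) (t : nat) : bool :=
  halted P (run P w t).

(* The answer of a halted computation is "yes" when X_0 > 0. *)
Definition answers (P : program) (w : seq nat) (b : bool) : Prop :=
  exists t, halts_within P w t /\ (0 < reg (run P w t) 0) = b.

Definition bits (n : nat) (G : bigraph n) : seq nat :=
  [seq nat_of_bool ((i, j) \in (G : {set _})) | i <- enum 'I_n, j <- enum 'I_n].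

Definition encode (n : nat) (G G' : bigraph n) : seq nat :=
  n :: bits G ++ bits G'.

(* The time bound is required on all pairs, also on those where the answer is
   allowed to be wrong. *)
Definition polynomial_time (P : program) : Prop :=
  exists p : {poly nat}, forall (n : nat) (G G' : bigraph n),
    halts_within P (encode G G') p.[n]%R.

Definition correct_on (P : program) (n : nat) (G G' : bigraph n) : Prop :=
  answers P (encode G G') (isomorphic G G').

Definition uniform_pr (R : realType) (T : finType) (E : {pred T}) : R :=
  (#|E|%:R / #|T|%:R)%R.

(* Main.v *)
Require Import Defs.
From HB Require Import structures.
From mathcomp Require Import all_boot all_order all_algebra all_fingroup.
From mathcomp Require Import all_classical all_reals all_analysis.
From mathcomp Require Import zify ring.
Set Implicit Arguments.
Unset Strict Implicit.
Unset Printing Implicit Defensive.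
Import Order.TTheory GRing.Theory Num.Theory.
Local Open Scope nat_scope.

(** The algorithm is colour refinement after individualization, run on the
    disjoint union of G and G'. Fix 2k seeds in G (k in each class, k a
    constant). For every choice of images of the seeds in G', colour each seed
    like its image, refine until the colouring is stable, send a vertex of G to
    the vertex of G' of the same colour and test whether this map is an
    isomorphism; answer yes when some choice passes. A positive answer carries
    a proof ([success_sound]). If G and G' are isomorphic, the choice that
    follows an isomorphism keeps the colours invariant under it, so it passes
    as soon as the stable colouring separates the vertices of G
    ([success_complete]). Hence only the graphs that have an equitable
    colouring with the seeds as singleton classes and yet two vertices of the
    same colour ([~ identifiable]) can cause an error.

    These graphs are counted by a first moment argument. Let f and g send a
    vertex of the first and of the second class to a representative of its
    colour within the class. If i is not a representative and j is one, then
    the bit (i, j) is determined by the remaining bits, because i and f i have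
    the same degree into the colour class of j. So a pair (f, g) for which f
    has x non-fixed points and g has b fixed points accounts for at most
    2 ^ (n ^ 2 - x * b) graphs ([card_row_regular]). Exchanging the two classes
    if necessary, f has at most as many fixed points as g. There are at most
    'C(n, x) (n - x) ^ x choices of f ([card_idempotents]), and the gain
    2 ^ (x * b) beats the number of pairs (f, g) by a factor exponential in n,
    whether b is of order n or x is ([pair_count_bound]); the seeds ensure
    that b is never small. If f and g are both the identity, then two vertices
    of different classes share a colour, and counting paths of length two from
    a seed shows that two rows of the bit matrix are disjoint, which has
    probability (3 / 4) ^ n ([mixed_class_disjoint_rows],
    [card_disjoint_rows]). When 0 < n <= k every vertex is a seed, hence
    nothing is exceptional, so taking k large removes the small cases.

    To obtain an actual machine, the algorithm is written in a small language
    whose loops have at most 4 * n rounds; such programs compile to random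
    access machines ([compP]) that run in polynomial time
    ([ram_polynomial_time]). *)

(** * A loop language and its compilation to random access machines *)

(** [Idx k] is the counter of the loop, or the index of the sum, that encloses
    its occurrence at depth [k], counted from the outside: levels rather than
    de Bruijn indices, so that the counter at a given level has a register of
    its own. *)
Inductive expr : Type :=
| Lit of nat
| Idx of nat
| At of nat & expr
| Plus of expr & expr
| Minus of expr & expr
| Sum of expr & expr.

Inductive cmd : Type :=
| Skip
| Put of nat & expr & expr
| Inp of nat & expr
| Then of cmd & cmd
| Rep of expr & cmd.

(** A memory is a family of arrays; a variable is the entry 0 of an array. *)
Definition memory := nat -> nat -> nat.

Definition setm (m : memory) (a : nat) (f : nat -> nat) : memory :=
  fun b => if b == a then f else m b.

(** Sums, like the loops below, are cut off at [N] terms: this is what makes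
    every program polynomial, whatever its bounds evaluate to. *)
Fixpoint eval (N : nat) (e : expr) (l : nat) (ρ : nat -> nat) (m : memory)
    : nat :=
  match e with
  | Lit k => k
  | Idx k => ρ k
  | At a e => m a (eval N e l ρ m)
  | Plus e1 e2 => eval N e1 l ρ m + eval N e2 l ρ m
  | Minus e1 e2 => eval N e1 l ρ m - eval N e2 l ρ m
  | Sum e1 e2 =>
      \sum_(0 <= k < minn (eval N e1 l ρ m) N) eval N e2 l.+1 (upd ρ l k) m
  end.

Fixpoint den (N : nat) (c : cmd) (l : nat) (ρ : nat -> nat)
    (s : memory * seq nat) : memory * seq nat :=
  match c with
  | Skip => s
  | Put a e1 e2 =>
      (setm s.1 a (upd (s.1 a) (eval N e1 l ρ s.1) (eval N e2 l ρ s.1)), s.2)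
  | Inp a e =>
      (setm s.1 a (upd (s.1 a) (eval N e l ρ s.1) (head 0 s.2)), behead s.2)
  | Then c1 c2 => den N c2 l ρ (den N c1 l ρ s)
  | Rep e c =>
      iteri (minn (eval N e l ρ s.1) N)
            (fun k => den N c l.+1 (upd ρ l k)) s
  end.

(** This pairing is injective and never 0, which is left for the answer, and a
    machine without multiplication computes it from [h] by additions. The
    counters of the loops, the temporaries and the arrays of the program are
    kept apart by the first component. *)
Definition loc (a h : nat) : nat := 2 ^ a * h.*2.+1.
Definition ctr (l : nat) : nat := loc 0 l.
Definition bnd : nat := loc 1 0.
Definition tmp (d : nat) : nat := loc 1 d.+1.
Definition cell (a h : nat) : nat := loc a.+2 h.

Lemma loc_eq a h b k : (loc a h == loc b k) = (a == b) && (h == k).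
Proof.
apply/eqP/andP => [|[/eqP-> /eqP->]//].
rewrite /loc; elim: a b => [|a IH] [|b]; rewrite ?expn0 ?mul1n ?expnS.
- by case=> /double_inj->.
- by move/(congr1 odd); rewrite -mulnA mul2n /= !odd_double.
- by move/(congr1 odd); rewrite -mulnA mul2n /= !odd_double.
by rewrite -!mulnA => /eqP; rewrite eqn_mul2l /= => /eqP /IH [/eqP-> ->].
Qed.

Lemma loc_gt0 a h : 0 < loc a h.
Proof. by rewrite /loc muln_gt0 expn_gt0. Qed.

Lemma updE r i a j : upd r i a j = if j == i then a else r j.
Proof. by []. Qed.

Lemma neqnS n : ((n == n.+1) = false) * ((n.+1 == n) = false)
              * ((n == n.+2) = false) * ((n.+2 == n) = false).
Proof. by do !split; apply/eqP; lia. Qed.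

Definition regE := (updE, loc_eq, eqxx, eqSS, neqnS, andbF, andbT, andTb).

(** The doublings turn the index in [tmp d] into a register number; compare
    [loc]. *)
Definition addr (a d : nat) : seq instr :=
  [:: Defs.Const (tmp d.+1) 1; Defs.Add (tmp d) (tmp d) (tmp d);
      Defs.Add (tmp d) (tmp d) (tmp d.+1)]
  ++ nseq a.+2 (Defs.Add (tmp d) (tmp d) (tmp d)).

Definition clamp (d : nat) : seq instr :=
  [:: Defs.Sub (tmp d.+1) (tmp d) bnd; Defs.Sub (tmp d) (tmp d) (tmp d.+1)].

(** The test is at the end, in front of the backward jump, and the loop is
    entered there, so that a loop with bound 0 runs no round. Since the only
    jump is conditional, a scratch register is set to 1 to enter. *)
Definition loop (q l d : nat) (body : seq instr) : seq instr :=
  [:: Defs.Const (ctr l) 0; Defs.Const (tmp d.+1) 1;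
      JumpPos (tmp d.+1) (q + size body + 5)]
  ++ body ++
  [:: Defs.Const (tmp d.+1) 1; Defs.Add (ctr l) (ctr l) (tmp d.+1);
      Defs.Sub (tmp d.+1) (tmp d) (ctr l); JumpPos (tmp d.+1) (q + 3)].

(** Code to be placed at address [q] that leaves the value in [tmp d]. It is
    free to use the temporaries from [d] on and the counters from [l] on; the
    smaller ones belong to the enclosing expressions and loops. *)
Fixpoint comp_expr (e : expr) (q l d : nat) : seq instr :=
  match e with
  | Lit k => [:: Defs.Const (tmp d) k]
  | Idx k => [:: Defs.Const (tmp d) 0; Defs.Add (tmp d) (ctr k) (tmp d)]
  | At a e => comp_expr e q l d ++ addr a d ++ [:: Fetch (tmp d) (tmp d)]
  | Plus e1 e2 =>
      let c1 := comp_expr e1 q l d in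
      c1 ++ comp_expr e2 (q + size c1) l d.+1
         ++ [:: Defs.Add (tmp d) (tmp d) (tmp d.+1)]
  | Minus e1 e2 =>
      let c1 := comp_expr e1 q l d in
      c1 ++ comp_expr e2 (q + size c1) l d.+1
         ++ [:: Defs.Sub (tmp d) (tmp d) (tmp d.+1)]
  | Sum e1 e2 =>
      let c1 := comp_expr e1 q l d.+1 ++ clamp d.+1
                ++ [:: Defs.Const (tmp d) 0] in
      let q1 := q + size c1 in
      c1 ++ loop q1 l d.+1
              (comp_expr e2 (q1 + 3) l.+1 d.+2
               ++ [:: Defs.Add (tmp d) (tmp d) (tmp d.+2)])
  end.

Fixpoint comp (c : cmd) (q l d : nat) : seq instr :=
  match c with
  | Skip => [::]
  | Put a e1 e2 =>
      let c1 := comp_expr e1 q l d ++ addr a d in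
      c1 ++ comp_expr e2 (q + size c1) l d.+1 ++ [:: Store (tmp d) (tmp d.+1)]
  | Inp a e =>
      comp_expr e q l d ++ addr a d
      ++ [:: Read (tmp d.+1); Store (tmp d) (tmp d.+1)]
  | Then c1 c2 =>
      let k1 := comp c1 q l d in k1 ++ comp c2 (q + size k1) l d
  | Rep e c =>
      let c1 := comp_expr e q l d ++ clamp d in
      let q1 := q + size c1 in
      c1 ++ loop q1 l d (comp c (q1 + 3) l.+1 d.+1)
  end.

Fixpoint closed_expr (l : nat) (e : expr) : bool :=
  match e with
  | Lit _ => true
  | Idx k => k < l
  | At _ e => closed_expr l e
  | Plus e1 e2 | Minus e1 e2 => closed_expr l e1 && closed_expr l e2
  | Sum e1 e2 => closed_expr l e1 && closed_expr l.+1 e2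
  end.

Fixpoint closed_cmd (l : nat) (c : cmd) : bool :=
  match c with
  | Skip => true
  | Put _ e1 e2 => closed_expr l e1 && closed_expr l e2
  | Inp _ e => closed_expr l e
  | Then c1 c2 => closed_cmd l c1 && closed_cmd l c2
  | Rep e c => closed_expr l e && closed_cmd l.+1 c
  end.

Fixpoint ecost (N : nat) (e : expr) : nat :=
  match e with
  | Lit _ => 1
  | Idx _ => 2
  | At a e => ecost N e + (a + 6)
  | Plus e1 e2 | Minus e1 e2 => ecost N e1 + (ecost N e2 + 1)
  | Sum e1 e2 => ecost N e1 + 3 + (N * (ecost N e2 + 1 + 4) + 5)
  end.

Fixpoint cost (N : nat) (c : cmd) : nat :=
  match c with
  | Skip => 0
  | Put a e1 e2 => ecost N e1 + (a + 5) + (ecost N e2 + 1)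
  | Inp a e => ecost N e + (a + 5) + 2
  | Then c1 c2 => cost N c1 + cost N c2
  | Rep e c => ecost N e + 2 + (N * (cost N c + 4) + 5)
  end.

Definition reach (P : program) (C C' : config) (T : nat) : Prop :=
  exists2 t, t <= T & iter t (Defs.step P) C = C'.

Lemma reach_trans P C2 C1 C3 T1 T2 :
  reach P C1 C2 T1 -> reach P C2 C3 T2 -> reach P C1 C3 (T1 + T2).
Proof.
case=> t1 le1 e1 [t2 le2 e2]; exists (t2 + t1).
  by rewrite addnC leq_add.
by rewrite iterD e1.
Qed.

Lemma reach_leq P C C' T T' : T <= T' -> reach P C C' T -> reach P C C' T'.
Proof. by move=> le [t lt e]; exists t => //; apply: leq_trans le. Qed.

Definition code_at (P : program) (q : nat) (c : seq instr) : Prop :=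
  forall i ins, onth c i = Some ins -> onth P (q + i) = Some ins.

Lemma code_at_cat P q c1 c2 :
  code_at P q (c1 ++ c2) <->
  code_at P q c1 /\ code_at P (q + size c1) c2.
Proof.
split=> [H|[H1 H2]].
  split=> i ins Hi.
    apply: H; rewrite onth_cat ifT //.
    by rewrite -onthTE Hi.
  rewrite -addnA; apply: H; rewrite onth_cat ifF; first by rewrite addKn.
  by apply/negbTE; rewrite -leqNgt leq_addr.
move=> i ins; rewrite onth_cat; case: ltnP => [_|le]; first exact: H1.
by move/H2; rewrite -addnA subnKC.
Qed.

Lemma code_at_cons P q i c :
  code_at P q (i :: c) <-> onth P q = Some i /\ code_at P q.+1 c.
Proof.
rewrite -cat1s; split.
  case/code_at_cat=> H1; rewrite addn1; split=> //.
  by have := H1 0 i erefl; rewrite addn0.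
case=> H1 H2; apply/code_at_cat; split; last by rewrite addn1.
by move=> k ins /onth1P[-> <-]; rewrite addn0.
Qed.

Lemma reach_step P q r w ins :
  onth P q = Some ins ->
  reach P (Config q r w) (exec ins (Config q r w)) 1.
Proof. by move=> E; exists 1 => //=; rewrite /Defs.step E. Qed.

Definition plain (i : instr) : bool :=
  match i with JumpPos _ _ | Read _ => false | _ => true end.

Definition effect (c : seq instr) (r : nat -> nat) : nat -> nat :=
  foldl (fun r i => reg (exec i (Config 0 r [::]))) r c.

Lemma reach_plain P c q r w :
  code_at P q c -> all plain c ->
  reach P (Config q r w) (Config (q + size c) (effect c r) w) (size c).
Proof.
elim: c q r => [|i c IH] q r /=; first by rewrite addn0; exists 0.
move/code_at_cons=> [Hq Hc] /andP[Hi Hall].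
rewrite -add1n; apply: reach_trans (reach_step _ _ Hq) _.
suff -> : exec i (Config q r w)
          = Config q.+1 (reg (exec i (Config 0 r [::]))) w.
  by rewrite add1n -addSnnS; apply: IH.
by case: i Hi {Hq}.
Qed.

Definition represents (N l : nat) (ρ : nat -> nat) (m : memory)
    (r : nat -> nat) : Prop :=
  [/\ r bnd = N, forall k, k < l -> r (ctr k) = ρ k &
      forall a h, r (cell a h) = m a h].

(** Operands that are waiting in lower temporaries must survive. *)
Definition keeps (d : nat) (r r' : nat -> nat) : Prop :=
  forall j, j < d -> r' (tmp j) = r (tmp j).

Lemma keeps_trans d r1 r2 r3 : keeps d r1 r2 -> keeps d r2 r3 -> keeps d r1 r3.
Proof. by move=> H1 H2 j lt; rewrite H2 // H1. Qed.

Lemma keepsW d d' r r' : d <= d' -> keeps d' r r' -> keeps d r r'.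
Proof. by move=> le H j lt; apply: H; apply: leq_trans le. Qed.

Lemma represents_tmp N l ρ m r d v :
  represents N l ρ m r -> represents N l ρ m (upd r (tmp d) v).
Proof.
case=> HN Hc Hm; split=> [|k lt|a h]; first by rewrite !regE.
  by rewrite !regE /= Hc.
by rewrite !regE /= Hm.
Qed.

Lemma keeps_tmp d d' r v : d <= d' -> keeps d r (upd r (tmp d') v).
Proof. by move=> le j lt; rewrite !regE /=; case: eqP => // E; lia. Qed.

Lemma represents_ctr N l ρ m r k v :
  l <= k -> represents N l ρ m r -> represents N l ρ m (upd r (ctr k) v).
Proof.
move=> le [HN Hc Hm]; split=> [|j lt|a h]; first by rewrite !regE.
  by rewrite !regE /= Hc //; case: eqP => // E; lia.
by rewrite !regE /= Hm.
Qed.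

Lemma keeps_ctr d k r v : keeps d r (upd r (ctr k) v).
Proof. by move=> j lt; rewrite !regE. Qed.

Lemma represents_cell N l ρ m r a h v :
  represents N l ρ m r ->
  represents N l ρ (setm m a (upd (m a) h v)) (upd r (cell a h) v).
Proof.
move=> [HN Hc Hm]; split=> [|j lt|b k]; first by rewrite !regE.
  by rewrite !regE /= Hc.
rewrite !regE /setm; case: (b =P a) => [->|_] /=; last by rewrite Hm.
by rewrite /upd; case: eqP.
Qed.

Lemma effect_cat c1 c2 r : effect (c1 ++ c2) r = effect c2 (effect c1 r).
Proof. exact: foldl_cat. Qed.

Lemma effect_double k d r N l ρ m :
  let r' := effect (nseq k (Defs.Add (tmp d) (tmp d) (tmp d))) r in
  [/\ represents N l ρ m r -> represents N l ρ m r',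
      r' (tmp d) = 2 ^ k * r (tmp d) & keeps d r r'].
Proof.
elim: k r => [|k IH] r /=; first by rewrite mul1n.
have [H1 H2 H3] := IH (upd r (tmp d) (r (tmp d) + r (tmp d))); split.
- by move=> H; apply/H1/represents_tmp.
- by rewrite H2 updE eqxx addnn -mul2n mulnA -expnSr.
- exact: keeps_trans (keeps_tmp _ _ (leqnn d)) H3.
Qed.

Lemma addrP P q r w a d N l ρ m :
  code_at P q (addr a d) -> represents N l ρ m r ->
  exists r', [/\ reach P (Config q r w) (Config (q + size (addr a d)) r' w)
                       (a + 5),
    represents N l ρ m r', r' (tmp d) = cell a (r (tmp d)) & keeps d r r'].
Proof.
move=> Hc Hr.
have Hall : all plain (addr a d) by rewrite /addr all_cat all_nseq orbT.
set r0 := effect (take 3 (addr a d)) r.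
have r0E : r0 (tmp d) = (r (tmp d)).*2.+1.
  by rewrite /r0 /= !regE addn1 addnn.
have [H1 H2 H3] := effect_double a.+2 d r0 N l ρ m.
exists (effect (addr a d) r); rewrite /addr effect_cat; split.
- rewrite -effect_cat; apply: reach_leq (reach_plain _ _ Hc Hall).
  by rewrite /addr size_cat size_nseq /= addnC; lia.
- by apply: H1; do 3 apply: represents_tmp.
- by rewrite H2 r0E.
by apply: keeps_trans H3; do 3 (apply: keeps_trans (keeps_tmp _ _ _); last by []).
Qed.

Lemma clampP P q r w d N l ρ m :
  code_at P q (clamp d) -> represents N l ρ m r ->
  exists r', [/\ reach P (Config q r w) (Config (q + size (clamp d)) r' w) 2,
    represents N l ρ m r', r' (tmp d) = minn (r (tmp d)) N & keeps d r r'].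
Proof.
move=> Hc Hr; exists (effect (clamp d) r); split.
- exact: reach_plain Hc _.
- by do !apply: represents_tmp.
- rewrite /= !regE; case: Hr => -> _ _.
  by rewrite minnE.
by do 2 (apply: keeps_trans (keeps_tmp _ _ _); last by []).
Qed.

(** The invariant rule for compiled loops: the instructions around the body
    only write the counter and the scratch register [tmp d.+1], so an invariant
    that reads neither has to be checked on the body alone. *)
Lemma loopP P q l d body T b (I : nat -> (nat -> nat) -> seq nat -> Prop) r w :
  code_at P q (loop q l d body) ->
  (forall k r w v, I k r w -> I k (upd r (ctr l) v) w) ->
  (forall k r w v, I k r w -> I k (upd r (tmp d.+1) v) w) ->
  (forall k r w, k < b -> r (ctr l) = k -> r (tmp d) = b -> I k r w ->
     exists r' w',
       [/\ reach P (Config (q + 3) r w) (Config (q + 3 + size body) r' w') T,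
           I k.+1 r' w', r' (ctr l) = k & r' (tmp d) = b]) ->
  r (tmp d) = b -> I 0 r w ->
  exists r' w',
    [/\ reach P (Config q r w) (Config (q + size (loop q l d body)) r' w')
              (b * (T + 4) + 5),
        I b r' w' & r' (tmp d) = b].
Proof.
move=> Hc Ictr Itmp Hbody Hb H0.
have tdS : (tmp d == tmp d.+1) = false.
  by rewrite !regE.
have [Hpre] := (code_at_cat P q _ _).1 Hc.
move/(code_at_cat P _ body _)=> [_]; rewrite /= => Htail.
move: Hpre => /code_at_cons[P0 /code_at_cons[P1 /code_at_cons[P2 _]]].
move: Htail => /code_at_cons[Q0 /code_at_cons[Q1
               /code_at_cons[Q2 /code_at_cons[Q3 _]]]].
set qt := (q + 3 + size body).+2 in Q2 Q3.
have qtE : qt = q + size body + 5 by rewrite /qt; lia.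
have szE : q + size (loop q l d body) = qt.+2.
  by rewrite /loop !size_cat /= /qt; lia.
rewrite szE.
(* the state [k] rounds into the loop, at the test *)
have iterate k : k <= b -> exists r' w',
    [/\ reach P (Config q r w) (Config qt r' w') (k * (T + 4) + 3),
        I k r' w', r' (ctr l) = k & r' (tmp d) = b].
  elim: k => [|k IH] lekb.
    exists (upd (upd r (ctr l) 0) (tmp d.+1) 1), w; split.
    - rewrite mul0n.
      apply: (reach_trans (reach_step _ _ P0) (T2 := 2)).
      apply: (reach_trans (reach_step _ _ P1) (T2 := 1)).
      have := reach_step (upd (upd r (ctr l) 0) (tmp d.+1) 1) w P2.
      by rewrite /exec updE eqxx -qtE.
    - by apply/Itmp/Ictr.
    - by rewrite !regE.
    by rewrite updE tdS !regE.
  have [r1 [w1 [R1 I1 c1 b1]]] := IH (ltnW lekb).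
  pose r2 := upd r1 (tmp d.+1) (b - k).
  have R2 : reach P (Config qt r1 w1) (Config (q + 3) r2 w1) 2.
    apply: (reach_trans (reach_step _ _ Q2) (T2 := 1)) => /=.
    have e2 : r2 (tmp d.+1) = b - k by rewrite /r2 updE eqxx.
    rewrite c1 b1 -/r2.
    by have := reach_step r2 w1 Q3; rewrite /= e2 subn_gt0 lekb.
  have [||r3 [w3 [R3 I3 c3 b3]]] := Hbody k r2 w1 lekb _ _ (Itmp _ _ _ _ I1).
  - by rewrite /r2 !regE.
  - by rewrite /r2 updE tdS.
  exists (upd (upd r3 (tmp d.+1) 1) (ctr l) k.+1), w3; split.
  - have -> : k.+1 * (T + 4) + 3 = (k * (T + 4) + 3) + (2 + (T + 2)) by lia.
    apply: reach_trans R1 _; apply: reach_trans R2 _; apply: reach_trans R3 _.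
    apply: (reach_trans (reach_step _ _ Q0) (T2 := 1)) => /=.
    by have := reach_step (upd r3 (tmp d.+1) 1) w3 Q1; rewrite /= !regE /= c3 addn1.
  - by apply/Ictr/Itmp.
  - by rewrite !regE.
  - by rewrite !regE b3.
have [r1 [w1 [R1 I1 c1 b1]]] := iterate b (leqnn b).
exists (upd r1 (tmp d.+1) 0), w1; split.
- have -> : b * (T + 4) + 5 = b * (T + 4) + 3 + 2 by lia.
  apply: reach_trans R1 _.
  apply: (reach_trans (reach_step _ _ Q2) (T2 := 1)) => /=.
  rewrite c1 b1 subnn.
  by have := reach_step (upd r1 (tmp d.+1) 0) w1 Q3; rewrite /= updE eqxx.
- exact: Itmp.
by rewrite updE tdS.
Qed.

Lemma represents_push N l ρ m r k :
  r (ctr l) = k -> represents N l ρ m r -> represents N l.+1 (upd ρ l k) m r.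
Proof.
move=> ck [HN Hc Hm]; split=> // j; rewrite ltnS leq_eqVlt /upd.
by case: eqP => [-> //|_] /= /Hc.
Qed.

Lemma represents_pop N l ρ m r k :
  represents N l.+1 (upd ρ l k) m r -> represents N l ρ m r /\ r (ctr l) = k.
Proof.
case=> HN Hc Hm; split; last by rewrite Hc // updE eqxx.
by split=> // j lt; rewrite Hc ?ltnS 1?ltnW // updE (ltn_eqF lt).
Qed.

Local Opaque addr clamp loop.

Lemma comp_exprP N P e q l d ρ m r w :
  code_at P q (comp_expr e q l d) -> closed_expr l e -> represents N l ρ m r ->
  exists r', [/\
    reach P (Config q r w) (Config (q + size (comp_expr e q l d)) r' w)
          (ecost N e),
    represents N l ρ m r', r' (tmp d) = eval N e l ρ m & keeps d r r'].
Proof.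
elim: e q l d ρ r => [k|k|a e IH|e1 IH1 e2 IH2|e1 IH1 e2 IH2|e1 IH1 e2 IH2]
  q l d ρ r /=.
- move=> Hc _ Hr; exists (upd r (tmp d) k); split.
  + exact: reach_plain Hc _.
  + exact: represents_tmp.
  + by rewrite !regE.
  exact: keeps_tmp.
- move=> Hc lt Hr; exists (effect (comp_expr (Idx k) q l d) r); split.
  + exact: reach_plain Hc _.
  + by do !apply: represents_tmp.
  + by rewrite /= !regE addn0; case: Hr => _ -> .
  by do 2 apply: keeps_trans (keeps_tmp _ _ (leqnn d)).
- case/code_at_cat=> H1 /code_at_cat[H2 /code_at_cons[H3 _]] He Hr.
  have [r1 [R1 Hr1 E1 K1]] := IH _ _ _ _ _ H1 He Hr.
  have [r2 [R2 Hr2 E2 K2]] := addrP w H2 Hr1.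
  exists (upd r2 (tmp d) (r2 (r2 (tmp d)))); split.
  + have -> : a + 6 = a + 5 + 1 by lia.
    apply: reach_trans R1 _; apply: reach_trans R2 _.
    have := reach_step r2 w H3.
    by rewrite !size_cat /= !addnA addn1.
  + exact: represents_tmp.
  + by rewrite updE eqxx E2 E1; case: Hr2 => _ _ ->.
  by apply: keeps_trans (keeps_tmp _ _ (leqnn d)); apply: keeps_trans K2.
- case/code_at_cat=> H1 /code_at_cat[H2 /code_at_cons[H3 _]] /andP[He1 He2] Hr.
  have [r1 [R1 Hr1 E1 K1]] := IH1 _ _ _ _ _ H1 He1 Hr.
  have [r2 [R2 Hr2 E2 K2]] := IH2 _ _ _ _ _ H2 He2 Hr1.
  exists (upd r2 (tmp d) (r2 (tmp d) + r2 (tmp d.+1))); split.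
  + apply: reach_trans R1 _; apply: reach_trans R2 _.
    have := reach_step r2 w H3.
    by rewrite !size_cat /= !addnA addn1.
  + exact: represents_tmp.
  + by rewrite updE eqxx E2 K2 // E1.
  apply: keeps_trans (keeps_tmp _ _ (leqnn d)); apply: keeps_trans K1 _.
  exact: keepsW K2.
- case/code_at_cat=> H1 /code_at_cat[H2 /code_at_cons[H3 _]] /andP[He1 He2] Hr.
  have [r1 [R1 Hr1 E1 K1]] := IH1 _ _ _ _ _ H1 He1 Hr.
  have [r2 [R2 Hr2 E2 K2]] := IH2 _ _ _ _ _ H2 He2 Hr1.
  exists (upd r2 (tmp d) (r2 (tmp d) - r2 (tmp d.+1))); split.
  + apply: reach_trans R1 _; apply: reach_trans R2 _.
    have := reach_step r2 w H3.
    by rewrite !size_cat /= !addnA addn1.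
  + exact: represents_tmp.
  + by rewrite updE eqxx E2 K2 // E1.
  apply: keeps_trans (keeps_tmp _ _ (leqnn d)); apply: keeps_trans K1 _.
  exact: keepsW K2.
move=> /code_at_cat[/code_at_cat[H1 /code_at_cat[H2 /code_at_cons[H3 _]]] H4].
move=> /andP[He1 He2] Hr.
have [r1 [R1 Hr1 E1 K1]] := IH1 _ _ _ _ _ H1 He1 Hr.
have [r2 [R2 Hr2 E2 K2]] := clampP w H2 Hr1.
set q1 := q + size _ in H4 *; set body := _ ++ [:: _] in H4 *.
set b := minn _ _.
pose S k := \sum_(0 <= j < k) eval N e2 l.+1 (upd ρ l j) m.
pose r3 := upd r2 (tmp d) 0.
pose I k r' w' := [/\ represents N l ρ m r', r' (tmp d) = S k, keeps d r r'
                    & w' = w].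
have [|||||r4 [w4 [R4 [Hr4 E4 K4 Ew4] _]]] :=
  loopP (T := ecost N e2 + 1) (b := b) (I := I) (r := r3) (w := w) H4.
- move=> k r' w' v [Hr' E' K' Ew]; split=> //; first exact: represents_ctr.
    by rewrite !regE.
  exact: keeps_trans K' (@keeps_ctr _ _ _ _).
- move=> k r' w' v [Hr' E' K' Ew]; split=> //; first exact: represents_tmp.
    by rewrite !regE.
  by apply: keeps_trans K' (keeps_tmp _ _ _); lia.
- move=> k r' w' ltkb Ectr Ebnd [Hr' E' K' ->].
  have [H5 /code_at_cons[H6 _]] := (code_at_cat _ _ _ _).1
    ((code_at_cat _ _ _ _).1 ((code_at_cat _ _ _ _).1 H4).2).1.
  have [r5 [R5 Hr5 E5 K5]] := IH2 _ _ _ _ _ H5 He2 (represents_push Ectr Hr').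
  have [Hr6 c6] := represents_pop Hr5.
  exists (upd r5 (tmp d) (r5 (tmp d) + r5 (tmp d.+2))), w; split.
  + apply: reach_trans R5 _.
    have := reach_step r5 w H6.
    by rewrite /body size_cat /= !addnA addn1.
  + split=> //; first exact: represents_tmp.
      by rewrite updE eqxx E5 K5 // E' /S big_nat_recr.
    apply: keeps_trans (keeps_tmp _ _ (leqnn d)); apply: keeps_trans K' _.
    by apply: keepsW K5; lia.
  + by rewrite !regE.
  by rewrite !regE K5.
- by rewrite /r3 !regE E2 E1.
- split=> //.
  + exact: represents_tmp.
  + by rewrite /r3 updE eqxx /S big_nil.
  + apply: keeps_trans (keeps_tmp _ _ (leqnn d)).
    by apply: keeps_trans (keepsW _ K1) (keepsW _ K2).
- rewrite Ew4 in R4; rewrite size_cat addnA -/q1.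
  exists r4; split=> //.
  apply: reach_trans (_ : reach P _ (Config q1 r3 w) _) (reach_leq _ R4).
    apply: reach_trans R1 (_ : reach P _ _ 3).
    apply: reach_trans R2 _.
    have := reach_step r2 w H3.
    by rewrite /q1 !size_cat /= !addnA addn1.
  by rewrite leq_add2r leq_mul2r orbC geq_minr.
Qed.

(** The machine code simulates the denotation within [cost] steps. *)
Lemma compP N P c q l d ρ s r :
  code_at P q (comp c q l d) -> closed_cmd l c -> represents N l ρ s.1 r ->
  exists r', [/\
    reach P (Config q r s.2)
            (Config (q + size (comp c q l d)) r' (den N c l ρ s).2) (cost N c),
    represents N l ρ (den N c l ρ s).1 r' & keeps d r r'].
Proof.
elim: c q l d ρ s r => [|a e1 e2|a e|c1 IH1 c2 IH2|e c IH] q l d ρ s r.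
- by move=> _ _ Hr; exists r; rewrite addn0; split=> //; exists 0.
- case: s => m w; rewrite [comp _ _ _ _]/=.
  case/code_at_cat=> /code_at_cat[H1 H2] /code_at_cat[H3 /code_at_cons[H4 _]].
  move=> /andP[He1 He2] /= Hr.
  have [r1 [R1 Hr1 E1 K1]] := comp_exprP w H1 He1 Hr.
  have [r2 [R2 Hr2 E2 K2]] := addrP w H2 Hr1.
  have [r3 [R3 Hr3 E3 K3]] := comp_exprP w H3 He2 Hr2.
  exists (upd r3 (r3 (tmp d)) (r3 (tmp d.+1))); split.
  + apply: reach_trans (_ : reach P _ (Config (q + size (comp_expr e1 q l d ++ addr a d)) r2 w) _) _.
      by rewrite size_cat addnA; apply: reach_trans R1 R2.
    apply: reach_trans R3 _.
    have := reach_step r3 w H4.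
    by rewrite !size_cat /= !addnA addn1.
  + by rewrite K3 // E2 E1 E3; apply: represents_cell.
  rewrite K3 // E2 E3; apply: (@keeps_trans _ _ r3) => [|j lt]; last first.
    by rewrite !regE.
  by apply: keeps_trans K1 _; apply: keeps_trans K2 _; apply: keepsW K3.
- case: s => m w; rewrite [comp _ _ _ _]/=.
  case/code_at_cat=> H1 /code_at_cat[H2 /code_at_cons[H3 /code_at_cons[H4 _]]].
  move=> /= He Hr.
  have [r1 [R1 Hr1 E1 K1]] := comp_exprP w H1 He Hr.
  have [r2 [R2 Hr2 E2 K2]] := addrP w H2 Hr1.
  pose r3 := upd r2 (tmp d.+1) (head 0 w).
  have E3 : r3 (tmp d) = cell a (eval N e l ρ m) by rewrite /r3 !regE E2 E1.
  exists (upd r3 (r3 (tmp d)) (r3 (tmp d.+1))); split.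
  + rewrite -addnA; apply: reach_trans R1 _; apply: reach_trans R2 _.
    apply: (reach_trans (reach_step r2 w H3) (T2 := 1)) => /=.
    have := reach_step r3 (behead w) H4.
    by rewrite (size_cat (comp_expr _ _ _ _)) (size_cat (addr a d)) !addnA addn2.
  + rewrite E3 {2}/r3 updE eqxx; apply: represents_cell.
    exact: represents_tmp.
  rewrite E3; apply: (@keeps_trans _ _ r3) => [|j lt]; last by rewrite !regE.
  apply: keeps_trans K1 _; apply: keeps_trans K2 _; exact: keeps_tmp.
- move=> /code_at_cat[H1 H2] /andP[Hc1 Hc2] Hr.
  have [r1 [R1 Hr1 K1]] := IH1 _ _ _ _ _ _ H1 Hc1 Hr.
  have [r2 [R2 Hr2 K2]] := IH2 _ _ _ _ _ _ H2 Hc2 Hr1.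
  exists r2; split=> //; last exact: keeps_trans K1 K2.
  by rewrite /= size_cat addnA; apply: reach_trans R1 R2.
case: s => m w; rewrite [comp _ _ _ _]/=.
move=> /code_at_cat[/code_at_cat[H1 H2] H4] /andP[He Hcl] Hr.
have [r1 [R1 Hr1 E1 K1]] := comp_exprP w H1 He Hr.
have [r2 [R2 Hr2 E2 K2]] := clampP w H2 Hr1.
set q1 := q + size _ in H4 *; set body := comp c _ _ _ in H4 *.
rewrite /=; set b := minn _ _.
pose S k := iteri k (fun k => den N c l.+1 (upd ρ l k)) (m, w).
pose I k r' w' := [/\ represents N l ρ (S k).1 r', keeps d r r' & w' = (S k).2].
have [|||||r4 [w4 [R4 [Hr4 K4 Ew4] _]]] :=
  loopP (T := cost N c) (b := b) (I := I) (r := r2) (w := w) H4.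
- move=> k r' w' v [Hr' K' Ew]; split=> //; first exact: represents_ctr.
  exact: keeps_trans K' (@keeps_ctr _ _ _ _).
- move=> k r' w' v [Hr' K' Ew]; split=> //; first exact: represents_tmp.
  by apply: keeps_trans K' (keeps_tmp _ _ _); lia.
- move=> k r' w' ltkb Ectr Ebnd [Hr' K' ->].
  have [H5 _] := (code_at_cat _ _ _ _).1 ((code_at_cat _ _ _ _).1 H4).2.
  have [r5 [R5 Hr5 K5]] := IH _ _ _ _ _ _ H5 Hcl (represents_push Ectr Hr').
  have [Hr6 c6] := represents_pop Hr5.
  exists r5, (S k.+1).2; split=> //; last by rewrite K5.
  split=> //; apply: keeps_trans K' _; apply: keepsW K5; lia.
- by rewrite E2 E1.
- by split=> //; apply: keeps_trans K1 K2.
- rewrite Ew4 in R4; rewrite size_cat addnA -/q1.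
  exists r4; split=> //.
  apply: reach_trans (_ : reach P _ (Config q1 r2 w) _) (reach_leq _ R4).
    rewrite /q1 size_cat addnA; exact: reach_trans R1 R2.
  by rewrite leq_add2r leq_mul2r orbC geq_minr.
Qed.

(** The prelude reads [n] into the entry 0 of array 0 and stores the bound
    [4 * n], the number of vertices of both graphs; the epilogue copies the
    entry 0 of array [out] to the register of the answer. *)
Definition ram (c : cmd) (out : nat) : program :=
  [:: Read (cell 0 0); Defs.Add bnd (cell 0 0) (cell 0 0); Defs.Add bnd bnd bnd]
  ++ comp c 3 0 0 ++ [:: Defs.Const 0 0; Defs.Add 0 (cell out 0) 0].

Definition start (n : nat) (w : seq nat) : memory * seq nat :=
  (setm (fun _ _ => 0) 0 (upd (fun=> 0) 0 n), w).

Lemma ram_reach c out n w :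
  closed_cmd 0 c ->
  exists2 C, reach (ram c out) (Config 0 (fun=> 0) (n :: w)) C (cost (4 * n) c + 5)
    & halted (ram c out) C /\
      reg C 0 = (den (4 * n) c 0 (fun=> 0) (start n w)).1 out 0.
Proof.
move=> Hc; set P := ram c out; set s := den _ _ _ _ _.
have : code_at P 0 P by move=> i ins; rewrite add0n.
case/code_at_cat=> /code_at_cons[H0 /code_at_cons[H1 /code_at_cons[H2 _]]].
case/code_at_cat=> H3 /code_at_cons[H4 /code_at_cons[H5 _]].
pose r1 := upd (fun=> 0) (cell 0 0) n.
pose r2 := upd (upd r1 bnd (n + n)) bnd (n + n + (n + n)).
have R2 : reach P (Config 0 (fun=> 0) (n :: w)) (Config 3 r2 w) 3.
  apply: (reach_trans (reach_step _ _ H0) (T2 := 2)) => /=.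
  apply: (reach_trans (reach_step _ _ H1) (T2 := 1)) => /=.
  rewrite -/r1 (_ : r1 (cell 0 0) = n); last by rewrite /r1 updE eqxx.
  by have := reach_step (upd r1 bnd (n + n)) w H2; rewrite /= !updE !eqxx.
have Hr2 : represents (4 * n) 0 (fun=> 0) (start n w).1 r2.
  split=> [|//|a h]; first by rewrite /r2 updE eqxx; lia.
  rewrite /r2 /r1 /cell /bnd /= /setm !updE !loc_eq !eqSS /=.
  by case: a => [|a].
have [r3 [R3 [_ _ Hr3] _]] := compP H3 Hc Hr2.
exists (Config (size P) (upd (upd r3 0 0) 0 (s.1 out 0)) s.2).
  have -> : cost (4 * n) c + 5 = 3 + (cost (4 * n) c + (1 + 1)) by lia.
  apply: reach_trans R2 _; apply: reach_trans R3 _.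
  apply: (reach_trans (reach_step _ _ H4)) => /=.
  have := reach_step (upd r3 0 0) s.2 H5.
  rewrite /= updE (gtn_eqF (loc_gt0 _ _)) Hr3 updE eqxx addn0.
  by rewrite /P /ram !size_cat /= addn2.
by rewrite /halted /= updE eqxx.
Qed.

Lemma halted_stable P C t : halted P C -> iter t (Defs.step P) C = C.
Proof.
move=> H; elim: t => //= t ->; rewrite /Defs.step.
by rewrite onth_default.
Qed.

Lemma ram_halts c out n w T :
  closed_cmd 0 c -> cost (4 * n) c + 5 <= T ->
  halts_within (ram c out) (n :: w) T.
Proof.
move=> Hc le; have [C [t let_ E] [Hh _]] := ram_reach out n w Hc.
have leT : t <= T := leq_trans let_ le.
by rewrite /halts_within /run -(subnK leT) iterD E halted_stable.
Qed.

Lemma ram_answers c out n w b :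
  closed_cmd 0 c ->
  (0 < (den (4 * n) c 0 (fun=> 0) (start n w)).1 out 0) = b ->
  answers (ram c out) (n :: w) b.
Proof.
move=> Hc Hb; have [C [t let_ E] [Hh HE]] := ram_reach out n w Hc.
by exists t; rewrite /halts_within /run E HE.
Qed.

Definition polynomial_fun (f : nat -> nat) : Prop :=
  exists p : {poly nat}, forall n, f n = p.[n]%R.

Lemma polynomial_cst k : polynomial_fun (fun=> k).
Proof. by exists (k%:P)%R => n; rewrite hornerC. Qed.

Lemma polynomial_add f g :
  polynomial_fun f -> polynomial_fun g -> polynomial_fun (fun n => f n + g n).
Proof. by case=> p Hp [q Hq]; exists (p + q)%R => n; rewrite hornerD Hp Hq. Qed.

Lemma polynomial_loop f :
  polynomial_fun f -> polynomial_fun (fun n => 4 * n * f n).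
Proof.
case=> p Hp; exists (4%:P * 'X * p)%R => n.
by rewrite !hornerM hornerC hornerX Hp.
Qed.

(** Every loop runs at most [4 * n] rounds, so the nesting depth of the program
    bounds the degree of its running time. *)
Lemma polynomial_cost c : polynomial_fun (fun n => cost (4 * n) c).
Proof.
have He e : polynomial_fun (fun n => ecost (4 * n) e).
  by elim: e => /= *;
     repeat first [exact: polynomial_cst | assumption
                  | apply: polynomial_add | apply: polynomial_loop].
by elim: c => /= *;
   repeat first [exact: polynomial_cst | exact: He | assumption
                | apply: polynomial_add | apply: polynomial_loop].
Qed.

Lemma ram_polynomial_time c out : closed_cmd 0 c -> polynomial_time (ram c out).
Proof.
move=> Hc.
have [p Hp] := polynomial_add (polynomial_cost c) (polynomial_cst 5).
by exists p => n G G'; apply: ram_halts => //; rewrite -Hp.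
Qed.

(** * The isomorphism test as a loop program *)

(** A subexpression without sums means the same when it is moved under the
    binder of a further sum; [Sum] uses the current level for its index, so
    this fails for expressions that contain sums. *)
Fixpoint flat (l : nat) (e : expr) : bool :=
  match e with
  | Lit _ => true
  | Idx k => k < l
  | At _ e => flat l e
  | Plus e1 e2 | Minus e1 e2 => flat l e1 && flat l e2
  | Sum _ _ => false
  end.

Lemma eval_flat N e l l1 l2 k ρ m :
  flat l e -> eval N e l1 (upd ρ l k) m = eval N e l2 ρ m.
Proof.
elim: e => //= [j|a e IH|e1 IH1 e2 IH2|e1 IH1 e2 IH2].
- by rewrite updE => /ltn_eqF->.
- by move/IH->.
- by case/andP=> /IH1-> /IH2->.
- by case/andP=> /IH1-> /IH2->.
Qed.

Lemma den_rep N e c l ρ s (I : nat -> memory * seq nat -> Prop) :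
  let b := minn (eval N e l ρ s.1) N in
  I 0 s ->
  (forall k s, k < b -> I k s -> I k.+1 (den N c l.+1 (upd ρ l k) s)) ->
  I b (den N (Rep e c) l ρ s).
Proof.
move=> b I0 IS /=; rewrite -/b.
suff: forall k, k <= b -> I k (iteri k (fun k => den N c l.+1 (upd ρ l k)) s).
  exact.
by elim=> // k IH lt; apply: IS => //; apply/IH/ltnW.
Qed.

Fixpoint writes (c : cmd) : seq nat :=
  match c with
  | Skip => [::]
  | Put a _ _ | Inp a _ => [:: a]
  | Then c1 c2 => writes c1 ++ writes c2
  | Rep _ c => writes c
  end.

Lemma den_frame N c l ρ s a :
  a \notin writes c -> (den N c l ρ s).1 a = s.1 a.
Proof.
elim: c l ρ s => [|b e1 e2|b e|c1 IH1 c2 IH2|e c IH] l ρ s //=.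
- by rewrite inE /setm => /negPf->.
- by rewrite inE /setm => /negPf->.
- by rewrite mem_cat negb_or => /andP[H1 H2]; rewrite IH2 ?IH1.
move=> Ha; elim: (minn _ _) => //= k <-; exact: IH.
Qed.

(** The rule for filling an array. The entry [k] may depend on its old value
    and on the other arrays, but on no other entry, so the order of the
    assignments has no influence on the result. *)
Lemma den_map N e a E l ρ s b (F : nat -> nat) :
  eval N e l ρ s.1 = b -> b <= N ->
  (forall k m, k < b -> (forall i, i != a -> m i = s.1 i) ->
     m a k = s.1 a k -> eval N E l.+1 (upd ρ l k) m = F k) ->
  forall h, (den N (Rep e (Put a (Idx l) E)) l ρ s).1 a h
            = if h < b then F h else s.1 a h.
Proof.
move=> Eb leb HF.
pose I k (t : memory * seq nat) := (forall i, i != a -> t.1 i = s.1 i) /\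
  forall h, t.1 a h = if h < k then F h else s.1 a h.
have : I (minn (eval N e l ρ s.1) N) (den N (Rep e (Put a (Idx l) E)) l ρ s).
  apply: den_rep => [|k t]; first by split.
  rewrite Eb (minn_idPl leb) => ltk [H1 H2].
  split=> [i ne|h] /=; rewrite /setm; first by rewrite (negPf ne) H1.
  rewrite eqxx updE [upd ρ l k l]updE eqxx ltnS.
  case: (h =P k) => [->|/eqP ne].
    by rewrite leqnn HF // H2 ltnn.
  by rewrite H2 [h <= k]leq_eqVlt (negPf ne).
by rewrite Eb (minn_idPl leb); case.
Qed.

(** The arrays of the program: 0 holds [n], 1 the bits of the input, 2 the
    current colours, 3 the colours under construction, 4 the number of
    successful attempts, 5 the map from G to G'. The vertices are numbered from
    0 to [4 * n - 1]: the two classes of G, then the two classes of G'. *)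
Definition nn : expr := At 0 (Lit 0).
Definition nn2 : expr := Plus nn nn.
Definition nn4 : expr := Plus nn2 nn2.
Definition times_nn (e : expr) : expr := Sum nn e.
Definition dist (e1 e2 : expr) : expr := Plus (Minus e1 e2) (Minus e2 e1).

Definition read_input : cmd :=
  Rep nn2 (Rep nn (Inp 1 (Plus (times_nn (Idx 0)) (Idx 1)))).

(** The bit of the pair [(u, v)] in the graph whose vertices are numbered from
    [o] on and whose bits are stored from [b] on. The subtracted term vanishes
    if [u] is in the first class and [v] in the second one, and otherwise it is
    at least 1 and cancels whatever bit was fetched. *)
Definition edge (o b u v : expr) : expr :=
  Minus (At 1 (Plus (Plus b (times_nn (Minus u o))) (Minus v (Plus o nn))))
    (Plus (Plus (Minus o u) (Minus (Plus u (Lit 1)) (Plus o nn)))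
          (Plus (Minus (Plus o nn) v) (Minus (Plus v (Lit 1)) (Plus o nn2)))).

Definition adjacent (u v : expr) : expr :=
  Plus (Plus (edge (Lit 0) (Lit 0) u v) (edge (Lit 0) (Lit 0) v u))
       (Plus (edge nn2 (times_nn nn) u v) (edge nn2 (times_nn nn) v u)).

(** The [L] outermost loops choose the images of the [L] seeds, so that
    [Idx s] with [s < L] is the image of seed [s] and the loops of an attempt
    have the levels [L], [L.+1] and so on. *)
Section Body.
Variable K : nat.
Let L := K.*2.

(** The first [K] seeds are in the first class and the others in the second.
    Clipping at [n - 1] keeps the seeds inside the class when [n < K]: every
    vertex is then a seed, possibly several times. *)
Definition seed (s : nat) : expr :=
  let clip k := Minus (Lit k) (Minus (Lit k) (Minus nn (Lit 1))) in
  if s < K then clip s else Plus nn (clip (s - K)).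

Fixpoint mark (k : nat) : cmd :=
  if k is s.+1 then
    Then (mark s) (Then (Put 2 (seed s) (Lit s.+1)) (Put 2 (Idx s) (Lit s.+1)))
  else Rep nn4 (Put 2 (Idx L) (Lit 0)).

Definition same_class_neighbour (u d x : expr) : expr :=
  Minus (Lit 1) (Plus (Minus (Lit 1) (adjacent u x)) (dist (At 2 x) (At 2 d))).

(** The new colour of [u] lists, in base [4 * n + 1], the old colour of [u] and,
    for each vertex [d], the number of neighbours of [u] with the colour of
    [d]; the sum over all vertices that counts these neighbours also adds
    [4 * n] copies of the number built so far, which shifts its digits. Nothing
    is renumbered, so colours become integers with many bits, but
    equality of colours is exactly equality of these lists, and isomorphisms
    preserve colours on the nose. *)
Definition round : cmd :=
  Then (Rep nn4 (Put 3 (Idx L.+2) (At 2 (Idx L.+2))))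
  (Then (Rep nn4 (Rep nn4 (Put 3 (Idx L.+3)
           (Plus (At 3 (Idx L.+3)) (Sum nn4
              (Plus (At 3 (Idx L.+3))
                 (same_class_neighbour (Idx L.+3) (Idx L.+2) (Idx L.+4))))))))
        (Rep nn4 (Put 2 (Idx L.+2) (At 3 (Idx L.+2))))).

(** The sum of all vertices of G' with the colour of the given vertex, which is
    the vertex wanted if there is only one. The inner sum has one or no term
    and serves as a conditional. *)
Definition match_up : cmd :=
  Rep nn2 (Put 5 (Idx L)
    (Sum nn2 (Sum (Minus (Lit 1) (dist (At 2 (Idx L)) (At 2 (Plus nn2 (Idx L.+1)))))
                  (Plus nn2 (Idx L.+1))))).

(** Truncated subtraction turns each requirement into a term that vanishes
    exactly when it holds: two terms for the image of [u] being a vertex of G',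
    one for distinct vertices having distinct images and one for adjacency. *)
Definition violation (u v : expr) : expr :=
  Plus (Plus (Minus nn2 (At 5 u)) (Minus (Plus (At 5 u) (Lit 1)) nn4))
       (Plus (Minus (Lit 1) (Plus (dist (At 5 u) (At 5 v))
                                  (Minus (Lit 1) (dist u v))))
             (dist (adjacent u v) (adjacent (At 5 u) (At 5 v)))).

Definition verify : cmd :=
  Put 4 (Lit 0) (Plus (At 4 (Lit 0))
    (Minus (Lit 1) (Sum nn2 (Sum nn2 (violation (Idx L) (Idx L.+1)))))).

Definition attempt : cmd :=
  Then (mark L) (Then (Rep nn4 (Rep nn4 round)) (Then match_up verify)).

Definition gi_test : cmd := Then read_input (iter L (Rep nn4) attempt).

Lemma gi_test_closed : closed_cmd 0 gi_test.
Proof.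
have Hseed s l : closed_expr l (seed s) by rewrite /seed; case: ifP.
have Hmark k : k <= L -> closed_cmd L (mark k).
  elim: k => [|k IH] lt; first by rewrite /= ltnS leqnn.
  rewrite -[closed_cmd _ _]/(closed_cmd L (mark k)
    && ((closed_expr L (seed k) && true) && ((k < L) && true))).
  by rewrite (IH (ltnW lt)) Hseed lt.
have Hlev : (L <= L.+1) * (L <= L.+2) * (L <= L.+3) * (L <= L.+4).
  by do !split; rewrite !leqW.
have Hatt : closed_cmd L attempt by rewrite /= Hmark //= !ltnS leqnn !Hlev.
have Hiter k : k <= L -> closed_cmd k (iter (L - k) (Rep nn4) attempt).
  move=> lek; rewrite -(subKn lek); move: (leq_subr k L).
  elim: (L - k) => [_|j IH lt]; first by rewrite subn0 subnn.
  rewrite (subKn lt) iterS /= subnSK //.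
  by have := IH (ltnW lt); rewrite subKn 1?ltnW.
by rewrite /=; have := Hiter 0 isT; rewrite subn0.
Qed.
End Body.

Section Semantics.
Variables (n : nat) (raw : nat -> nat).
Let N := 4 * n.

Definition holds_input (m : memory) : Prop := m 0 0 = n /\ m 1 = raw.

Lemma eval_plus e1 e2 l ρ m :
  eval N (Plus e1 e2) l ρ m = eval N e1 l ρ m + eval N e2 l ρ m.
Proof. by []. Qed.

Lemma eval_minus e1 e2 l ρ m :
  eval N (Minus e1 e2) l ρ m = eval N e1 l ρ m - eval N e2 l ρ m.
Proof. by []. Qed.

Lemma eval_at a e l ρ m : eval N (At a e) l ρ m = m a (eval N e l ρ m).
Proof. by []. Qed.

Lemma eval_sum e1 e2 l ρ m :
  eval N (Sum e1 e2) l ρ m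
  = \sum_(0 <= k < minn (eval N e1 l ρ m) N) eval N e2 l.+1 (upd ρ l k) m.
Proof. by []. Qed.

Lemma eval_nn2 l ρ m : holds_input m -> eval N nn2 l ρ m = n.*2.
Proof. by case=> /= -> _; rewrite addnn. Qed.

Lemma eval_nn4 l ρ m : holds_input m -> eval N nn4 l ρ m = N.
Proof. by case=> /= -> _; rewrite /N; lia. Qed.

Lemma eval_times_nn l ρ m e :
  holds_input m -> flat l e ->
  eval N (times_nn e) l ρ m = n * eval N e l ρ m.
Proof.
case=> Hn _ fl; rewrite /= Hn (minn_idPl _); last by rewrite leq_pmull.
under eq_bigr => k _ do rewrite (eval_flat N _ l k ρ m fl).
by rewrite sum_nat_const_nat subn0.
Qed.

Definition edge_bit (o b u v : nat) : nat :=
  raw (b + n * (u - o) + (v - (o + n)))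
  - (((o - u) + (u + 1 - (o + n))) + ((o + n - v) + (v + 1 - (o + (n + n))))).

Definition adjacency (u v : nat) : nat :=
  edge_bit 0 0 u v + edge_bit 0 0 v u
  + (edge_bit (n + n) (n * n) u v + edge_bit (n + n) (n * n) v u).

Lemma eval_edge l ρ m o b u v :
  holds_input m -> flat l o -> flat l u ->
  eval N (edge o b u v) l ρ m
  = edge_bit (eval N o l ρ m) (eval N b l ρ m) (eval N u l ρ m) (eval N v l ρ m).
Proof.
move=> Hm fo fu; have [Hn Hr] := Hm.
have := eval_times_nn (e := Minus u o) ρ Hm.
rewrite /edge /edge_bit -Hr /= Hn => -> //.
by rewrite fo fu.
Qed.

Lemma eval_adjacent l ρ m u v :
  holds_input m -> flat l u -> flat l v ->
  eval N (adjacent u v) l ρ m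
  = adjacency (eval N u l ρ m) (eval N v l ρ m).
Proof.
move=> Hm fu fv; have [Hn _] := Hm.
pose ev e := eval N e l ρ m.
rewrite -[LHS]/(ev (edge (Lit 0) (Lit 0) u v) + ev (edge (Lit 0) (Lit 0) v u)
  + (ev (edge nn2 (times_nn nn) u v) + ev (edge nn2 (times_nn nn) v u))).
by rewrite /ev !eval_edge // eval_times_nn //= Hn.
Qed.

(** ** Colour refinement *)

Definition class_degree (c : nat -> nat) (u d : nat) : nat :=
  \sum_(0 <= x < N) (0 < adjacency u x) && (c x == c d).

Definition refine (c : nat -> nat) (u : nat) : nat :=
  iteri N (fun d a => a * N.+1 + class_degree c u d) (c u).

Definition agree (c c' : nat -> nat) : Prop := forall h, h < N -> c h = c' h.

Lemma sum_nn4 l ρ m e :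
  holds_input m ->
  eval N (Sum nn4 e) l ρ m = \sum_(0 <= k < N) eval N e l.+1 (upd ρ l k) m.
Proof.
by move=> Hm; move: (eval_nn4 l ρ Hm) => /= ->; rewrite minnn.
Qed.

Lemma sum_nn2 l ρ m e :
  holds_input m ->
  eval N (Sum nn2 e) l ρ m = \sum_(0 <= k < n.*2) eval N e l.+1 (upd ρ l k) m.
Proof.
move=> Hm; move: (eval_nn2 l ρ Hm) => /= ->; rewrite (minn_idPl _) //.
by rewrite /N; lia.
Qed.

Lemma rep_nn4 c l ρ s (I : nat -> memory * seq nat -> Prop) :
  holds_input s.1 -> I 0 s ->
  (forall k s, k < N -> I k s -> I k.+1 (den N c l.+1 (upd ρ l k) s)) ->
  I N (den N (Rep nn4 c) l ρ s).
Proof.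
move=> Hs I0 IS; have := @den_rep N nn4 c l ρ s I.
by move: (eval_nn4 l ρ Hs) => /= ->; rewrite minnn; apply.
Qed.

Lemma map_nn4 a E l ρ s (F : nat -> nat) :
  holds_input s.1 ->
  (forall k m, k < N -> (forall i, i != a -> m i = s.1 i) ->
     m a k = s.1 a k -> eval N E l.+1 (upd ρ l k) m = F k) ->
  agree ((den N (Rep nn4 (Put a (Idx l) E)) l ρ s).1 a) F.
Proof.
move=> Hs HF h lth; have := @den_map N nn4 a E l ρ s N F (eval_nn4 _ _ Hs).
by move=> /(_ (leqnn N) HF h); rewrite lth.
Qed.

Lemma den_put a e1 e2 l ρ s :
  (den N (Put a e1 e2) l ρ s).1 a
  = upd (s.1 a) (eval N e1 l ρ s.1) (eval N e2 l ρ s.1).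
Proof. by rewrite /= /setm eqxx. Qed.

Lemma frame_input c l ρ s :
  0 \notin writes c -> 1 \notin writes c ->
  holds_input s.1 -> holds_input (den N c l ρ s).1.
Proof. by move=> H0 H1 []; split; rewrite den_frame. Qed.

Lemma eval_same_class_neighbour l ρ m u d x :
  holds_input m -> flat l u -> flat l x ->
  eval N (same_class_neighbour u d x) l ρ m
  = (0 < adjacency (eval N u l ρ m) (eval N x l ρ m)) &&
    (m 2 (eval N x l ρ m) == m 2 (eval N d l ρ m)).
Proof.
move=> Hm fu fx; rewrite /same_class_neighbour eval_minus eval_plus eval_minus eval_adjacent //=.
by case: posnP => H; case: eqP => /= E; lia.
Qed.

Variable K : nat.
Let L := K.*2.

Lemma den_round ρ s c :
  holds_input s.1 -> agree (s.1 2) c ->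
  agree ((den N (round K) L.+2 ρ s).1 2) (refine c).
Proof.
move=> Hs Hc; rewrite /round -/L; set c1 := Rep nn4 _; set c2 := Rep nn4 (Rep _ _).
set s1 := den N c1 L.+2 ρ s; set s2 := den N c2 L.+2 ρ s1.
have H1 : holds_input s1.1 by apply: frame_input.
have H2 : holds_input s2.1 by apply: frame_input.
have E1 : agree (s1.1 3) c.
  move=> h lth; rewrite -Hc //; move: h lth; apply: map_nn4 => // k m ltk Hm _.
  by rewrite /= updE eqxx Hm.
have F1 : agree (s1.1 2) c by rewrite /s1 den_frame.
have F2 : agree (s2.1 2) c by rewrite /s2 den_frame.
suff E2 : agree (s2.1 3) (refine c).
  move=> h lth; rewrite -E2 //; move: h lth.
  rewrite -[den _ _ _ _ _]/(den N (Rep nn4 (Put 2 (Idx L.+2) (At 3 (Idx L.+2)))) L.+2 ρ s2).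
  apply: map_nn4 => // k m ltk Hm _.
  by rewrite /= updE eqxx Hm.
pose I k (t : memory * seq nat) := [/\ holds_input t.1, agree (t.1 2) c &
  agree (t.1 3) (fun u => iteri k (fun d a => a * N.+1 + class_degree c u d) (c u))].
suff: I N s2 by case.
apply: rep_nn4 => // d t ltd [Ht Htc Hte]; split.
- exact: frame_input.
- by rewrite den_frame.
move=> h lth; rewrite iteriS -Hte //; move: h lth.
apply: map_nn4 => // u m ltu Hm Hmu.
have Him : holds_input m by case: Ht => T0 T1; split; rewrite Hm.
rewrite eval_plus sum_nn4 //.
have -> : t.1 3 u * N.+1 + class_degree c u d
  = t.1 3 u + \sum_(0 <= x < N) (t.1 3 u + (0 < adjacency u x) && (c x == c d)).
  by rewrite big_split /= sum_nat_const_nat subn0 mulnS addnA mulnC.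
congr (_ + _); first by rewrite /= updE eqxx Hmu.
rewrite !big_nat; apply: eq_bigr => x /andP[_ ltx].
rewrite eval_plus eval_same_class_neighbour; [|exact: Him|by rewrite /= !ltnS leqW|by rewrite /=].
rewrite /=.
rewrite !updE !eqxx !neqnS Hmu; congr (_ + _).
by rewrite !Hm // !Htc.
Qed.

Definition seed_vertex (s : nat) : nat :=
  let clip k := k - (k - (n - 1)) in
  if s < K then clip s else n + clip (s - K).

Fixpoint seed_colours (w : nat -> nat) (k : nat) : nat -> nat :=
  if k is s.+1 then
    upd (upd (seed_colours w s) (seed_vertex s) s.+1) (w s) s.+1
  else fun=> 0.

Lemma eval_seed l ρ m s :
  holds_input m -> eval N (seed K s) l ρ m = seed_vertex s.
Proof. by case=> Hn _; rewrite /seed /seed_vertex; case: ifP => _ /=; rewrite Hn. Qed.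

Lemma writes_mark k : writes (mark K k) =i [:: 2].
Proof.
by elim: k => // k IH x; rewrite /= mem_cat IH !inE; case: eqP.
Qed.

Lemma den_mark k ρ s :
  holds_input s.1 -> agree ((den N (mark K k) L ρ s).1 2) (seed_colours ρ k).
Proof.
move=> Hs; elim: k => [|k IH] h lth.
  by move: h lth; apply: map_nn4.
have Hk : holds_input (den N (mark K k) L ρ s).1.
  by apply: frame_input; rewrite ?writes_mark.
set t := den N (mark K k) L ρ s in IH Hk *.
rewrite -[den _ _ _ _ _]/(den N (Put 2 (Idx k) (Lit k.+1)) L ρ
  (den N (Put 2 (seed K k) (Lit k.+1)) L ρ t)).
by rewrite !den_put /= eval_seed // /upd IH.
Qed.

Definition colours (w : nat -> nat) : nat -> nat :=
  iter (N * N) refine (seed_colours w L).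

Lemma den_rounds ρ s c :
  holds_input s.1 -> agree (s.1 2) c ->
  agree ((den N (Rep nn4 (Rep nn4 (round K))) L ρ s).1 2)
        (iter (N * N) refine c).
Proof.
move=> Hs Hc.
pose I b k (t : memory * seq nat) :=
  holds_input t.1 /\ agree (t.1 2) (iter (b * N + k) refine c).
suff [_] : I N 0 (den N (Rep nn4 (Rep nn4 (round K))) L ρ s) by rewrite addn0.
apply: (rep_nn4 (I := fun b => I b 0)) => // b t _ [Ht Htc].
have -> : I b.+1 0 = I b N by rewrite /I mulSn addn0 addnC.
apply: rep_nn4 => // k {Ht Htc}t _ [Ht Htc].
split; first exact: frame_input.
by rewrite addnS; apply: den_round.
Qed.

Hypothesis n_gt0 : 0 < n.

Definition partner (c : nat -> nat) (u : nat) : nat :=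
  \sum_(0 <= k < n.*2) (c u == c (n.*2 + k)) * (n.*2 + k).

Lemma den_match_up ρ s c u :
  holds_input s.1 -> agree (s.1 2) c -> u < n.*2 ->
  (den N (match_up K) L ρ s).1 5 u = partner c u.
Proof.
move=> Hs Hc ltu.
have le2N : n.*2 + n.*2 <= N by rewrite /N; lia.
have := @den_map N nn2 5 _ L ρ s n.*2 (partner c) (eval_nn2 _ _ Hs) _ _ u.
rewrite ltu; apply => [|{ltu}u m ltu Hm _]; first by rewrite /N; lia.
have Him : holds_input m by case: Hs => T0 T1; split; rewrite Hm.
rewrite sum_nn2 // /partner !big_nat; apply: eq_bigr => k /andP[_ ltk].
have e2 l r : eval N nn2 l r m = n.*2 by rewrite eval_nn2.
rewrite eval_sum; under eq_bigr => i _ do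
  rewrite eval_plus e2 /= -/L !updE !neqnS eqxx.
rewrite /dist !(eval_plus, eval_minus) !eval_at eval_plus e2 /=.
rewrite !updE !eqxx !neqnS !Hm // !Hc; [|lia..].
rewrite sum_nat_const_nat subn0.
have [->|ne] := eqVneq (c u) (c (n.*2 + k)).
  by rewrite subnn (minn_idPl _) // /N; lia.
have -> : 1 - (c u - c (n.*2 + k) + (c (n.*2 + k) - c u)) = 0 by lia.
by rewrite min0n.
Qed.

Definition violations (c : nat -> nat) (u v : nat) : nat :=
  let p := partner c in
  (n.*2 - p u) + (p u + 1 - N)
  + (1 - ((p u - p v) + (p v - p u) + (1 - ((u - v) + (v - u))))
     + ((adjacency u v - adjacency (p u) (p v))
        + (adjacency (p u) (p v) - adjacency u v))).

Definition matched (c : nat -> nat) (u v : nat) : Prop :=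
  [/\ n.*2 <= partner c u < N, partner c u = partner c v -> u = v
    & adjacency u v = adjacency (partner c u) (partner c v)].

Definition success (w : nat -> nat) : Prop :=
  forall u v, u < n.*2 -> v < n.*2 -> matched (colours w) u v.

Lemma violations_eq0 c u v : violations c u v = 0 <-> matched c u v.
Proof.
rewrite /violations /matched /=; set p := partner c; set a := adjacency u v.
set b := adjacency _ _; split=> [H|[/andP[H1 H2] H3 H4]].
  split; [apply/andP; split| |]; lia.
have [E|ne] := eqVneq (p u) (p v); first by rewrite -(H3 E); lia.
lia.
Qed.

Lemma eval_violation l ρ m u v :
  holds_input m -> flat l u -> flat l v ->
  let p x := m 5 (eval N x l ρ m) in
  let a := eval N u l ρ m in let b := eval N v l ρ m in
  eval N (violation u v) l ρ m
  = (n.*2 - p u) + (p u + 1 - N)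
    + (1 - ((p u - p v) + (p v - p u) + (1 - ((a - b) + (b - a))))
       + ((adjacency a b - adjacency (p u) (p v))
          + (adjacency (p u) (p v) - adjacency a b))).
Proof.
move=> Hm fu fv p a b; rewrite /violation.
have := eval_adjacent ρ Hm fu fv.
have := @eval_adjacent l ρ m (At 5 u) (At 5 v) Hm fu fv.
have := eval_nn2 l ρ Hm; have := eval_nn4 l ρ Hm.
move: nn4 nn2 (adjacent u v) (adjacent (At 5 u) (At 5 v)) => e1 e2 e3 e4.
by move=> /= -> -> -> ->.
Qed.

Lemma den_verify ρ s w :
  holds_input s.1 ->
  (forall u, u < n.*2 -> s.1 5 u = partner (colours w) u) ->
  0 < (den N (verify K) L ρ s).1 4 0 <-> 0 < s.1 4 0 \/ success w.
Proof.
move=> Hs Hp.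
have -> : (den N (verify K) L ρ s).1 4 0 = s.1 4 0 + (1 -
    \sum_(0 <= u < n.*2) \sum_(0 <= v < n.*2) violations (colours w) u v).
  rewrite /verify -/L den_put eval_plus eval_minus sum_nn2 // updE eqxx.
 congr (_ + (1 - _)).
  rewrite !big_nat; apply: eq_bigr => u /andP[_ ltu].
  rewrite sum_nn2 // !big_nat; apply: eq_bigr => v /andP[_ ltv].
  rewrite eval_violation; [|exact: Hs|by rewrite /= ltnS leqW|by rewrite /=].
  by rewrite /= !updE !eqxx !neqnS !Hp.
split=> [|[lt|H]].
- case: (posnP (s.1 4 0)) => [->|lt _]; last by left.
  rewrite add0n subn_gt0 ltnS leqn0 => H; right => u v ltu ltv.
  apply: (violations_eq0 (colours w) u v).1; apply/eqP; move: H.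
  rewrite big_mkord sum_nat_eq0 => /forallP/(_ (Ordinal ltu)) /=.
  by rewrite big_mkord sum_nat_eq0 => /forallP/(_ (Ordinal ltv)).
- by rewrite ltn_addr.
rewrite big_nat big1 ?subn0 ?addn1 // => u /andP[_ ltu].
by rewrite big_nat big1 // => v /andP[_ ltv]; apply: (violations_eq0 _ u v).2 (H u v ltu ltv).
Qed.

Lemma den_attempt ρ s :
  holds_input s.1 ->
  0 < (den N (attempt K) L ρ s).1 4 0 <-> 0 < s.1 4 0 \/ success ρ.
Proof.
move=> Hs; rewrite /attempt -/L.
set c1 := mark K L; set c2 := Rep nn4 (Rep nn4 (round K)); set c3 := match_up K.
set s1 := den N c1 L ρ s; set s2 := den N c2 L ρ s1; set s3 := den N c3 L ρ s2.
rewrite -[den N (Then _ _) _ _ _]/(den N (verify K) L ρ s3).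
have H1 : holds_input s1.1 by apply: frame_input; rewrite ?writes_mark.
have H2 : holds_input s2.1 by apply: frame_input.
have H3 : holds_input s3.1 by apply: frame_input.
have -> : s.1 4 = s3.1 4 by rewrite !den_frame // writes_mark.
apply: den_verify => // u ltu; apply: den_match_up => //.
by apply: den_rounds => //; apply: den_mark.
Qed.

Lemma seed_colours_ext w w' k :
  (forall s, s < k -> w s = w' s) -> seed_colours w k = seed_colours w' k.
Proof.
elim: k => //= k IH H; rewrite IH ?H // => s lt; apply: H; exact: ltnW.
Qed.

Lemma success_ext w w' :
  (forall s, s < L -> w s = w' s) -> success w -> success w'.
Proof. by move=> H; rewrite /success /colours (seed_colours_ext H). Qed.

(** The nested loops try all images of the last [j] seeds. *)
Lemma den_attempts j ρ s :
  j <= L -> holds_input s.1 ->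
  0 < (den N (iter j (Rep nn4) (attempt K)) (L - j) ρ s).1 4 0 <->
  0 < s.1 4 0 \/
  exists w, [/\ forall t, t < L - j -> w t = ρ t,
                forall t, L - j <= t < L -> w t < N & success w].
Proof.
have keepin i l ρ' t : holds_input t.1 ->
    holds_input (den N (iter i (Rep nn4) (attempt K)) l ρ' t).1.
  have Hw : writes (iter i (Rep nn4) (attempt K)) = writes (attempt K).
    by elim: i.
  by apply: frame_input; rewrite Hw /= mem_cat writes_mark.
elim: j ρ s => [|j IH] ρ s lej Hs.
  rewrite subn0 den_attempt //; split=> -[|H]; [by left|right|by left|].
    by exists ρ; split=> // t /andP[]; case: ltnP.
  by case: H => w [H1 _ H3]; right; apply: success_ext H3.
set l := L - j.+1; have lS : l.+1 = L - j by rewrite /l; lia.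
have ltl : l < L by rewrite /l; lia.
pose I k (t : memory * seq nat) := holds_input t.1 /\
  (0 < t.1 4 0 <-> 0 < s.1 4 0 \/
   exists w, [/\ forall t, t < l -> w t = ρ t, w l < k,
                 forall t, l < t < L -> w t < N & success w]).
have [_ ->] : I N (den N (iter j.+1 (Rep nn4) (attempt K)) l ρ s).
  apply: rep_nn4 => //.
    by split=> //; split=> [H|[//|[w []]]]; [left|].
  move=> k t ltk [Ht Hf]; split; first exact: keepin.
  have := IH (upd ρ l k) t (ltnW lej) Ht; rewrite -lS => ->.
  rewrite Hf; split.
    case=> [[H|[w [H1 H2 H3 H4]]]|[w [H1 H2 H3]]]; first by left.
      by right; exists w; split=> //; apply: leqW.
    right; exists w; split=> // [i lti|].
    - by rewrite H1 1?ltnW // updE (ltn_eqF lti).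
    - by rewrite H1 // updE eqxx.
  case=> [H|[w [H1 H2 H3 H4]]]; first by left; left.
  have [ltw|gew] := ltnP (w l) k; first by left; right; exists w.
  right; exists w; split=> // i; rewrite ltnS updE.
  by case: eqP => [-> _|ne le]; [lia|apply: H1; lia].
split=> -[H|[w Hw]]; [by left| |by left|]; right; exists w.
  case: Hw => H1 H2 H3 H4; split=> // i /andP[lei lti].
  by have [->//|ne] := eqVneq i l; apply: H3; lia.
by case: Hw => H1 H2 H3; split=> // [|i /andP[lt1 lt2]]; apply: H2; lia.
Qed.
End Semantics.

(** ** Reading the input *)

Lemma den_inp N a e l ρ s :
  (den N (Inp a e) l ρ s).1 a = upd (s.1 a) (eval N e l ρ s.1) (head 0 s.2).
Proof. by rewrite /= /setm eqxx. Qed.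

Lemma den_read_input n ρ w :
  let s := den (4 * n) read_input 0 ρ (start n w) in
  [/\ s.1 0 0 = n, s.1 4 0 = 0 &
      s.1 1 = fun h => if h < n.*2 * n then nth 0 w h else 0].
Proof.
move=> s; rewrite {}/s.
pose J k (t : memory * seq nat) := [/\ t.1 0 0 = n, t.1 4 0 = 0, t.2 = drop k w
  & t.1 1 = fun h => if h < k then nth 0 w h else 0].
suff [H1 H2 _ H3] : J (n.*2 * n) (den (4 * n) read_input 0 ρ (start n w)) by [].
have E2 : minn (eval (4 * n) nn2 0 ρ (start n w).1) (4 * n) = n.*2.
  by rewrite /= /setm /upd /= addnn (minn_idPl _) //; lia.
rewrite -E2; apply: (den_rep (I := fun k => J (k * n))).
  by split=> //; rewrite /= ?drop0 // /setm /=; apply/funext.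
move=> i t _ Ht; have [T0 _ _ _] := Ht.
have E1 ρ' : minn (eval (4 * n) nn 1 ρ' t.1) (4 * n) = n.
  by rewrite /= T0 (minn_idPl _) //; lia.
have -> : J (i.+1 * n) = J (i * n + n) by rewrite mulSn addnC.
rewrite -[in X in J (_ + X)](E1 (upd ρ 0 i)).
apply: (den_rep (I := fun k => J (i * n + k))); first by rewrite addn0.
move=> j {Ht T0 E1}t _ [T0 T4 Tw T1]; set c := Inp _ _.
have ET : eval (4 * n) (Plus (times_nn (Idx 0)) (Idx 1)) 2 (upd (upd ρ 0 i) 1 j) t.1
    = i * n + j.
  by rewrite eval_plus (@eval_times_nn n (t.1 1)) //= mulnC.
split; first by rewrite den_frame.
- by rewrite den_frame.
- by rewrite [LHS]/= Tw -drop1 drop_drop add1n addnS.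
rewrite den_inp ET T1; apply/funext => h; rewrite /upd Tw -nth0 nth_drop addn0.
by rewrite addnS ltnS [h <= _]leq_eqVlt; case: eqP => [->|].
Qed.

(** ** The adjacency of the two input graphs *)

Lemma nth_allpairs (S T : Type) (f : S -> T -> nat) s t i j x0 y0 :
  i < size s -> j < size t ->
  nth 0 [seq f x y | x <- s, y <- t] (i * size t + j)
  = f (nth x0 s i) (nth y0 t j).
Proof.
elim: s i => //= x s IH [|i] lti ltj; rewrite nth_cat size_map.
  by rewrite mul0n add0n ltj (nth_map y0).
by rewrite mulSn -addnA ltnNge leq_addr /= addKn IH.
Qed.

Lemma size_bits n (G : bigraph n) : size (bits G) = n * n.
Proof. by rewrite size_allpairs size_enum_ord. Qed.

Lemma nth_bits n (G : bigraph n) (i j : 'I_n) :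
  nth 0 (bits G) (n * i + j) = ((i, j) \in G).
Proof.
have := @nth_allpairs _ _ (fun i j => nat_of_bool ((i, j) \in G))
  (enum 'I_n) (enum 'I_n) i j i j.
by rewrite size_enum_ord mulnC /bits => -> //; rewrite !nth_ord_enum.
Qed.

Definition code n (x : vertex n) : nat :=
  match x with inl i => val i | inr j => n + val j end.

Lemma code_lt n (x : vertex n) : code x < n.*2.
Proof. by case: x => i /=; have := ltn_ord i; lia. Qed.

Lemma code_inj n : injective (@code n).
Proof.
move=> [i|i] [j|j] /= E; have := ltn_ord i; have := ltn_ord j => *.
- by congr inl; apply: val_inj.
- by exfalso; lia.
- by exfalso; lia.
- by congr inr; apply: val_inj => /=; lia.
Qed.

Lemma code_onto n u : u < n.*2 -> exists x : vertex n, code x = u.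
Proof.
move=> lt; case: (ltnP u n) => [lt1|ge].
  by exists (inl (Ordinal lt1)).
have lt2 : u - n < n by lia.
by exists (inr (Ordinal lt2)) => /=; lia.
Qed.

Lemma sum_code n (F : nat -> nat) :
  \sum_(0 <= u < n.*2) F u = \sum_(x : vertex n) F (code x).
Proof.
rewrite big_sumType /= -addnn (big_cat_nat (n := n)) //= ?leq_addr //.
rewrite -{2}[n]add0n big_addn addnK !big_mkord.
by congr (_ + _); apply: eq_bigr => i _; rewrite addnC.
Qed.

Section Pair.
Variables (n : nat) (G G' : bigraph n).
Let raw h := nth 0 (bits G ++ bits G') h.

Lemma raw_le1 h : raw h <= 1.
Proof.
rewrite /raw; case: (ltnP h (size (bits G ++ bits G'))) => [lt|ge]; last first.
  by rewrite nth_default.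
have le1 (H : bigraph n) : all (fun b => b <= 1) (bits H).
  by apply/allP => b /allpairsP[[i j] [_ _ ->]]; apply: leq_b1.
have : all (fun b => b <= 1) (bits G ++ bits G') by rewrite all_cat !le1.
by move/all_nthP; apply.
Qed.

Lemma edge_bit_in o b (i j : 'I_n) :
  edge_bit n raw o b (o + i) (o + (n + j)) = raw (b + (n * i + j)).
Proof.
have := ltn_ord i; have := ltn_ord j => ltj lti; rewrite /edge_bit.
by rewrite addKn !addnA (_ : o + n + j - (o + n) = j); lia.
Qed.

Lemma edge_bit_out o b u v :
  ~~ ((o <= u < o + n) && (o + n <= v < o + (n + n))) ->
  edge_bit n raw o b u v = 0.
Proof. by have := raw_le1; move=> H; rewrite /edge_bit; have := H (b + n * (u - o) + (v - (o + n))); lia. Qed.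

Lemma raw_fst (i j : 'I_n) : raw (0 + (n * i + j)) = ((i, j) \in G).
Proof.
rewrite /raw add0n nth_cat size_bits ifT ?nth_bits //.
have := ltn_ord i; have := ltn_ord j => ltj lti.
have : n * i.+1 <= n * n by rewrite leq_mul2l lti orbT.
by rewrite mulnS; lia.
Qed.

Lemma raw_snd (i j : 'I_n) : raw (n * n + (n * i + j)) = ((i, j) \in G').
Proof. by rewrite /raw nth_cat size_bits ltnNge leq_addr /= addKn nth_bits. Qed.

Lemma adjacency_fst x y :
  adjacency n raw (code x) (code y) = adj G x y.
Proof.
rewrite /adjacency; case: x => i; case: y => j /=;
  have := ltn_ord i; have := ltn_ord j => ltj lti.
- by rewrite !edge_bit_out //; lia.
- rewrite -(raw_fst i j) -(edge_bit_in 0 0) !add0n.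
  by rewrite [edge_bit n raw 0 0 (n + j) i]edge_bit_out ?[edge_bit n raw (n + n) _ _ _]edge_bit_out; lia.
- rewrite -(raw_fst j i) -(edge_bit_in 0 0) !add0n.
  by rewrite [edge_bit n raw 0 0 (n + i) j]edge_bit_out ?[edge_bit n raw (n + n) _ _ _]edge_bit_out; lia.
- by rewrite !edge_bit_out //; lia.
Qed.

Lemma adjacency_snd x y :
  adjacency n raw (n.*2 + code x) (n.*2 + code y) = adj G' x y.
Proof.
rewrite -addnn /adjacency; case: x => i; case: y => j /=;
  have := ltn_ord i; have := ltn_ord j => ltj lti.
- by rewrite !edge_bit_out //; lia.
- rewrite -(raw_snd i j) -(edge_bit_in (n + n) (n * n)).
  by rewrite [edge_bit n raw (n + n) _ (n + n + (n + j)) _]edge_bit_out ?[edge_bit n raw 0 0 _ _]edge_bit_out; lia.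
- rewrite -(raw_snd j i) -(edge_bit_in (n + n) (n * n)).
  by rewrite [edge_bit n raw (n + n) _ (n + n + (n + i)) _]edge_bit_out ?[edge_bit n raw 0 0 _ _]edge_bit_out; lia.
- by rewrite !edge_bit_out //; lia.
Qed.

Lemma adjacency_cross (x y : vertex n) :
  adjacency n raw (code x) (n.*2 + code y) = 0 /\
  adjacency n raw (n.*2 + code x) (code y) = 0.
Proof.
have := code_lt x; have := code_lt y; rewrite -addnn /adjacency => lty ltx.
by split; rewrite !edge_bit_out //; lia.
Qed.

Lemma sum_both (F : nat -> nat) :
  \sum_(0 <= u < 4 * n) F u
  = \sum_(x : vertex n) F (code x) + \sum_(x : vertex n) F (n.*2 + code x).
Proof.
rewrite (big_cat_nat (n := n.*2)) //=; last by lia.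
rewrite sum_code -{1}[n.*2]add0n big_addn (_ : 4 * n - n.*2 = n.*2); last by lia.
rewrite (sum_code n (fun u => F (u + n.*2))).
by congr (_ + _); apply: eq_bigr => x _; rewrite addnC.
Qed.

Lemma class_degree_fst c x d :
  class_degree n raw c (code x) d
  = \sum_(y : vertex n) adj G x y && (c (code y) == c d).
Proof.
rewrite /class_degree sum_both [X in _ + X]big1 ?addn0 => [|y _]; last first.
  by rewrite (adjacency_cross x y).1.
by apply: eq_bigr => y _; rewrite adjacency_fst; case: adj.
Qed.

Lemma class_degree_snd c x d :
  class_degree n raw c (n.*2 + code x) d
  = \sum_(y : vertex n) adj G' x y && (c (n.*2 + code y) == c d).
Proof.
rewrite /class_degree sum_both big1 ?add0n => [|y _]; last first.
  by rewrite (adjacency_cross x y).2.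
by apply: eq_bigr => y _; rewrite adjacency_snd; case: adj.
Qed.

End Pair.

(** ** Stability of the refined colouring *)

Section Stability.
Variables (n : nat) (raw : nat -> nat).
Let N := 4 * n.
Notation degree := (class_degree n raw).
Notation refined := (refine n raw).

Lemma class_degree_le c u d : degree c u d <= N.
Proof.
apply: (@leq_trans (\sum_(0 <= x < N) 1)).
  by apply: leq_sum => x _; apply: leq_b1.
by rewrite sum_nat_const_nat subn0 muln1.
Qed.

(** Unique digits: a class degree is at most [N], so it can be read off the
    number to which it was appended in base [N.+1]. *)
Lemma refineP c u v :
  refined c u = refined c v <->
  c u = c v /\ forall d, d < N -> degree c u d = degree c v d.
Proof.
have step a a' b b' : b <= N -> b' <= N ->
    a * N.+1 + b = a' * N.+1 + b' <-> a = a' /\ b = b'.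
  move=> leb leb'; split=> [E|[-> ->] //].
  have Ea : a = a'.
    have := congr1 (divn^~ N.+1) E.
    by rewrite !divnMDl // !divn_small ?ltnS // !addn0.
  by split=> //; move: E; rewrite Ea => /addnI.
rewrite /refine -/N.
suff H k : iteri k (fun d a => a * N.+1 + degree c u d) (c u)
         = iteri k (fun d a => a * N.+1 + degree c v d) (c v) <->
         c u = c v /\ forall d, d < k -> degree c u d = degree c v d by exact: H.
elim: k => [|k IH]; first by split=> [|[]].
rewrite !iteriS step ?class_degree_le // IH; split.
  case=> -[-> H] Hk; split=> // d; rewrite ltnS leq_eqVlt => /predU1P[->//|].
  exact: H.
by case=> -> H; split; [split=> // d lt; apply/H/ltnW|apply: H].
Qed.

Lemma refine_kernel c u v :
  (forall x y, x < N -> y < N -> (c x == c y) = (refined c x == refined c y)) ->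
  u < N -> v < N -> c u = c v -> forall d, d < N -> degree c u d = degree c v d.
Proof.
move=> H ltu ltv E d ltd; have : refined c u == refined c v by rewrite -H // E.
by move/eqP/refineP => -[_]; apply.
Qed.

Definition same_colour (c : nat -> nat) : {set 'I_N * 'I_N} :=
  [set p | c (val p.1) == c (val p.2)].

Lemma same_colour_refine c : same_colour (refined c) \subset same_colour c.
Proof. by apply/fintype.subsetP => p; rewrite !inE => /eqP/refineP[-> _]. Qed.

(** Class degrees only depend on the partition into colour classes, so once a
    round does not split any class no later round does. *)
Lemma same_colour_stable c c' :
  same_colour c = same_colour c' ->
  same_colour (refined c) = same_colour (refined c').
Proof.
move=> H.
have eqc u v : u < N -> v < N -> (c u == c v) = (c' u == c' v).
  by move=> ltu ltv; have /setP/(_ (Ordinal ltu, Ordinal ltv)) := H; rewrite !inE.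
have eqd u d : d < N -> degree c u d = degree c' u d.
  move=> ltd; rewrite /class_degree !big_nat; apply: eq_bigr => x /andP[_ ltx].
  by rewrite eqc.
apply/setP => -[u v]; rewrite !inE /=.
apply/eqP/eqP => /refineP[E1 E2]; apply/refineP; split.
- by apply/eqP; rewrite -eqc ?E1.
- by move=> d ltd; rewrite -!eqd ?E2.
- by apply/eqP; rewrite eqc ?E1.
- by move=> d ltd; rewrite !eqd ?E2.
Qed.

(** As long as the colouring is not stable every round removes a pair of
    vertices from the relation of having the same colour, and there are only
    [N * N] pairs. *)
Lemma refinement_stable c u v :
  let k := iter (N * N) refined c in
  u < N -> v < N -> k u = k v -> forall d, d < N -> degree k u d = degree k v d.
Proof.
move=> k ltu ltv; apply: refine_kernel => //.
suff E : same_colour k = same_colour (refined k).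
  by move=> x y ltx lty; have /setP/(_ (Ordinal ltx, Ordinal lty)) := E; rewrite !inE.
apply/eqP/contraT => ne.
have neq t : t <= N * N ->
    same_colour (iter t refined c) != same_colour (iter t.+1 refined c).
  move=> let_; apply: contraNneq ne => E; rewrite /k -(subnK let_) iterD.
  elim: (_ - _) => [|i IH] /=; first exact/eqP.
  by apply/eqP/same_colour_stable/eqP.
have card t : t <= (N * N).+1 -> #|same_colour (iter t refined c)| + t <= N * N.
  elim: t => [|t IH] lt.
    rewrite addn0; apply: leq_trans (max_card _) _.
    by rewrite card_prod card_ord.
  rewrite addnS; apply: leq_trans (IH (ltnW lt)); rewrite -addSn leq_add2r.
  by apply: proper_card; rewrite finset.properEneq eq_sym neq //= same_colour_refine.
by have := card _ (leqnn _); rewrite addnS; lia.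
Qed.

Lemma refinement_refines c t u v :
  iter t refined c u = iter t refined c v -> c u = c v.
Proof. by elim: t => //= t IH /refineP[/IH]. Qed.

End Stability.

(** ** Correctness of the test *)

Definition equitable n (G : bigraph n) (k : vertex n -> nat) : Prop :=
  forall x y, k x = k y -> forall z,
    \sum_(t : vertex n) (adj G x t && (k t == k z))
    = \sum_(t : vertex n) (adj G y t && (k t == k z)).

Definition is_seed n (K : nat) (x : vertex n) : bool :=
  match x with inl i => val i < K | inr j => val j < K end.

Definition isolates n (K : nat) (k : vertex n -> nat) : Prop :=
  forall x y, is_seed K x -> k x = k y -> x = y.

(** The property of G alone that ensures a correct answer. It quantifies over
    arbitrary colourings and does not mention the algorithm, which makes it
    accessible to counting. *)
Definition identifiable n (K : nat) (G : bigraph n) : Prop :=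
  forall k, equitable G k -> isolates K k -> injective k.

Section Correctness.
Variables (n K : nat) (G G' : bigraph n).
Hypothesis n_gt0 : 0 < n.
Let N := 4 * n.
Let raw h := nth 0 (bits G ++ bits G') h.

(** Whatever the colours are, the verified map is an injection of the vertices
    of G into those of G' that preserves adjacency. *)
Lemma success_sound w : success n raw K w -> isomorphic G G'.
Proof.
set p := partner n (colours n raw K w) => H.
have lt2 := @code_lt n.
have Hf (x : vertex n) : exists y : vertex n, p (code x) = n.*2 + code y.
  have [/andP[le lt] _ _] := H _ _ (lt2 x) (lt2 x); rewrite -/p in le lt.
  have [|y Hy] := @code_onto n (p (code x) - n.*2); first by lia.
  by exists y; rewrite Hy subnKC.
have Hf' (x : vertex n) : exists y : vertex n, p (code x) == n.*2 + code y.
  by have [y ->] := Hf x; exists y.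
pose f x := xchoose (Hf' x).
have fP x : p (code x) = n.*2 + code (f x) by apply/eqP/(xchooseP (Hf' x)).
have f_inj : injective f.
  move=> x y E; apply: code_inj.
  have [_ Hinj _] := H _ _ (lt2 x) (lt2 y).
  by apply: Hinj; rewrite -/p !fP E.
apply/existsP; exists (perm f_inj); apply/forallP => x; apply/forallP => y.
rewrite !permE; have [_ _] := H _ _ (lt2 x) (lt2 y).
rewrite -/p !fP adjacency_fst adjacency_snd => E.
by apply/eqP/esym; move: E; do 2 case: adj.
Qed.

Lemma seed_vertex_lt s : s < K.*2 -> seed_vertex n K s < n.*2.
Proof. by rewrite /seed_vertex; case: ifP => _; lia. Qed.

Lemma seed_vertexP (x : vertex n) :
  is_seed K x -> exists2 s, s < K.*2 & seed_vertex n K s = code x.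
Proof.
case: x => i /= lt; have := ltn_ord i => lti.
  by exists i; rewrite /seed_vertex ?lt; lia.
by exists (K + i); rewrite /seed_vertex ?ltnNge ?leq_addr /=; lia.
Qed.

Lemma seed_colours_le w k u : seed_colours n K w k u <= k.
Proof.
elim: k u => //= k IH u; rewrite /upd; case: eqP => // _; case: eqP => // _.
exact/leqW/IH.
Qed.

(** The images of the seeds lie in G' and later marks overwrite earlier ones,
    so a positive colour of a vertex of G names the last seed that it is. *)
Lemma seed_colours_isolates w k s u v :
  (forall t, t < k -> n.*2 <= w t) -> u < n.*2 -> v < n.*2 ->
  s < k -> seed_vertex n K s = u ->
  seed_colours n K w k u = seed_colours n K w k v -> u = v.
Proof.
move=> Hw ltu ltv; elim: k s Hw => // k IH s Hw lts Es.
have neu : (u == w k) = false by apply/eqP; have := Hw k (leqnn _); lia.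
have nev : (v == w k) = false by apply/eqP; have := Hw k (leqnn _); lia.
have leu := seed_colours_le w k u; have lev := seed_colours_le w k v.
rewrite /= /upd neu nev; case: eqP => [->|neu'].
  by case: eqP => [->//|_] E; lia.
case: eqP => [_|_]; first by lia.
move: lts; rewrite ltnS leq_eqVlt => /predU1P[E|lts]; first by rewrite -E Es in neu'.
by apply: (IH s) => // t lt; apply/Hw/ltnW.
Qed.

(** Let the seeds have their images under an isomorphism. Then all colours
    are invariant under the isomorphism, by induction on the rounds. The final
    colouring of G is equitable and isolates the seeds, hence separates the
    vertices of G, and the vertex of G' with the colour of [x] is the image of
    [x]. *)
Lemma success_complete :
  isomorphic G G' -> identifiable K G ->
  exists2 w, forall t, t < K.*2 -> w t < N & success n raw K w.
Proof.
case/existsP=> f /forallP Hf Hid.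
have {}Hf x y : adj G' (f x) (f y) = adj G x y.
  by have /forallP/(_ y)/eqP := Hf x.
have Hv s : exists x : vertex n, (s < K.*2) ==> (code x == seed_vertex n K s).
  case: (ltnP s K.*2) => [lt|_]; last by exists (inl (Ordinal n_gt0)).
  have [x Hx] := code_onto (seed_vertex_lt lt).
  by exists x; rewrite Hx eqxx.
pose vs s := xchoose (Hv s).
have vsP s : s < K.*2 -> code (vs s) = seed_vertex n K s.
  by move=> lt; have /implyP/(_ lt)/eqP := xchooseP (Hv s).
pose w s := n.*2 + code (f (vs s)).
exists w => [t _|]; first by have := code_lt (f (vs t)); rewrite /w /N; lia.
set c := colours n raw K w.
have c0f x k : k <= K.*2 -> seed_colours n K w k (code x)
                 = seed_colours n K w k (n.*2 + code (f x)).
  elim: k => //= k IH lt; rewrite /upd (IH (ltnW lt)) {IH} -(vsP k lt).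
  have -> : (code x == w k) = false by apply/eqP; have := code_lt x; rewrite /w; lia.
  have -> : (n.*2 + code (f x) == code (vs k)) = false.
    by apply/eqP; have := code_lt (vs k); lia.
  by rewrite eqn_add2l !(inj_eq (@code_inj n)) (inj_eq perm_inj).
have ctf t x : iter t (refine n raw) (seed_colours n K w K.*2) (code x)
      = iter t (refine n raw) (seed_colours n K w K.*2) (n.*2 + code (f x)).
  elim: t x => [|t IH] x /=; first exact: c0f.
  set ct := iter t _ _ in IH *.
  rewrite /refine IH; apply: eq_iteri => i a; congr (_ + _).
  rewrite class_degree_fst class_degree_snd [RHS](reindex_perm f) /=.
  by apply: eq_bigr => y _; rewrite Hf IH.
have cf x : c (code x) = c (n.*2 + code (f x)) by apply: ctf.
have lt4 (x : vertex n) : code x < N by have := code_lt x; rewrite /N; lia.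
have c_inj : injective (fun x : vertex n => c (code x)).
  apply: Hid => [x y E z|x y /seed_vertexP[s lts Es] E].
    have := refinement_stable (lt4 x) (lt4 y) E (lt4 z).
    by rewrite !class_degree_fst.
  apply: code_inj; apply: (@seed_colours_isolates w K.*2 s) => //.
  - by move=> t _; rewrite leq_addr.
  - exact: code_lt.
  - exact: code_lt.
  exact: refinement_refines E.
have pE x : partner n c (code x) = n.*2 + code (f x).
  rewrite /partner sum_code (reindex_perm f) (bigD1 x) //= -cf eqxx mul1n.
  rewrite big1 ?addn0 // => y ne.
  by rewrite -cf (inj_eq c_inj) eq_sym (negPf ne).
move=> u v /code_onto[x <-] /code_onto[y <-]; split; rewrite -/c !pE.
- by rewrite leq_addr /= /N; have := code_lt (f x); lia.
- by move/addnI/code_inj/perm_inj->.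
by rewrite adjacency_fst adjacency_snd Hf.
Qed.

End Correctness.

(** The error is one-sided because positive answers are verified. *)
Theorem gi_testP n K (G G' : bigraph n) :
  0 < n ->
  let run := den (4 * n) (gi_test K) 0 (fun=> 0) (start n (bits G ++ bits G')) in
  (0 < run.1 4 0 -> isomorphic G G') /\
  (isomorphic G G' -> identifiable K G -> 0 < run.1 4 0).
Proof.
move=> n_gt0 s.
set w := bits G ++ bits G' in s *.
have [R0 R4 R1] := den_read_input n (fun=> 0) w.
set s0 := den _ _ _ _ _ in R0 R4 R1.
have Hraw : s0.1 1 = nth 0 w.
  rewrite R1; apply/funext => h; case: ltnP => // ge.
  by rewrite nth_default // size_cat !size_bits -mulnDl addnn.
have := @den_attempts n (nth 0 w) K n_gt0 K.*2 (fun=> 0) s0 (leqnn _) (conj R0 Hraw).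
rewrite subnn -[den _ _ _ _ _]/s R4 => H; split=> [/H[//|[u [_ _]]]|iso Hid].
  exact: success_sound.
apply/H; right; have [u H1 H2] := success_complete n_gt0 iso Hid.
by exists u; split=> // t /andP[_]; apply: H1.
Qed.

(** * Counting the graphs that are not identified *)

Section Counting.
Variable n : nat.
Implicit Types (f g : {ffun 'I_n -> 'I_n}) (G : {set 'I_n * 'I_n}).

Definition idempotent f : bool := [forall i, f (f i) == f i].

Definition fixed f : {set 'I_n} := [set i | f i == i].

Definition row_degree g G (i j : 'I_n) : nat :=
  \sum_(k | g k == j) ((i, k) \in G).

Definition row_regular f g : {set {set 'I_n * 'I_n}} :=
  [set G | [forall i, forall j in fixed g,
              row_degree g G i j == row_degree g G (f i) j]].

(** The bits at [(i, j)] with [i] not fixed and [j] fixed can be deleted without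
    loss: all the other bits that enter the two sums for [i] and [f i] over the
    class of [j] are retained, since [f i] is a fixed row and [j] is the only fixed
    column of its class. *)
Lemma card_row_regular f g :
  idempotent f -> idempotent g ->
  #|row_regular f g| * 2 ^ (#|~: fixed f| * #|fixed g|) <= 2 ^ (n * n).
Proof.
move=> /forallP ff /forallP gg.
pose Z := finset.setX (~: fixed f) (fixed g).
have cardZ : #|~: Z| + #|~: fixed f| * #|fixed g| = n * n.
  by rewrite -cardsX addnC cardsC card_prod card_ord.
rewrite -cardZ expnD leq_mul2r -card_powerset; apply/orP; right.
have inj : {in row_regular f g &, injective (fun G => G :&: ~: Z)}.
  move=> G H; rewrite !inE => /forallP HG /forallP HH E.
  have out p : p \notin Z -> (p \in G) = (p \in H).
    move=> np; have /finset.setP/(_ p) := E.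
    by rewrite !finset.in_setI !finset.in_setC np !andbT.
  apply/finset.setP => -[i j]; have [Zij|] := boolP ((i, j) \in Z); last exact: out.
  move: Zij; rewrite !inE /= => /andP[fi gj].
  have fixj : j \in fixed g by rewrite inE.
  have /forallP/(_ j) := HG i; rewrite fixj /= => /eqP EG.
  have /forallP/(_ j) := HH i; rewrite fixj /= => /eqP EH.
  have Ef : row_degree g G (f i) j = row_degree g H (f i) j.
    apply: eq_bigr => k _; congr (nat_of_bool _); apply: out.
    by rewrite !inE /= ff.
  have split_j A : row_degree g A i j
      = ((i, j) \in A) + \sum_(k | (g k == j) && (k != j)) ((i, k) \in A).
    by rewrite /row_degree (bigD1 j).
  move: EG; rewrite Ef -EH !split_j (eq_bigr (fun k => nat_of_bool ((i, k) \in H))).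
    by move/addIn; do 2 case: (_ \in _).
  move=> k /andP[/eqP gk nk]; congr (nat_of_bool _); apply: out.
  by rewrite !inE /= gk (eq_sym j) (negPf nk) andbF.
rewrite -(card_in_imset inj); apply: subset_leq_card.
apply/fintype.subsetP => _ /imsetP[G _ ->]; rewrite powersetE.
exact: finset.subsetIr.
Qed.

Definition idempotents (a : nat) : {set {ffun 'I_n -> 'I_n}} :=
  [set f | idempotent f && (#|fixed f| == a)].

(** Choose the fixed points, then a fixed point as image of every other
    point. *)
Lemma card_idempotents a : #|idempotents a| <= 'C(n, a) * a ^ (n - a).
Proof.
pose T := [set A : {set 'I_n} | #|A| == a].
have -> : #|idempotents a| = \sum_(A in T) #|[set f in idempotents a | fixed f == A]|.
  rewrite -sum1_card (partition_big fixed [in T]) => [|f]; last first.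
    by rewrite !inE => /andP[].
  by apply: eq_bigr => A _; rewrite -sum1_card; apply: eq_bigl => f; rewrite !inE.
rewrite -[n in 'C(n, a)]card_ord -card_draws -sum_nat_const -/T.
apply: leq_sum => A; rewrite inE => /eqP cA.
pose F (i : 'I_n) : pred 'I_n := fun j => if i \in A then j == i else j \in A.
apply: (@leq_trans #|family F|).
  apply/subset_leq_card/fintype.subsetP => f; rewrite !inE.
  move=> /andP[/andP[/forallP ff _] /eqP EA].
  by apply/familyP => i; rewrite unfold_in /F -EA !inE; case: ifP.
rewrite card_family foldrE big_map big_enum /= (bigID [in A]) /=.
rewrite big1 => [|i iA]; last first.
  by rewrite -[RHS](card1 i); apply: eq_card => j; rewrite inE unfold_in /F iA.
rewrite mul1n (eq_bigr (fun=> a)) => [|i iA]; last first.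
  by rewrite -cA; apply: eq_card => j; rewrite unfold_in /F (negPf iA).
rewrite prod_nat_const (_ : n - a = #|~: A|); last first.
  by rewrite cardsCs finset.setCK card_ord cA.
by rewrite (eq_card (B := ~: A)) // => i; rewrite !inE.
Qed.

Definition disjoint_rows (i0 i : 'I_n) : {set {set 'I_n * 'I_n}} :=
  [set G : {set 'I_n * 'I_n} |
    [forall j, ~~ (((i0, j) \in G) && ((i, j) \in G))]].

(** In each column only three of the four possible pairs of bits occur in the
    two rows. *)
Lemma card_disjoint_rows (i0 i : 'I_n) : i != i0 ->
  #|disjoint_rows i0 i| * 2 ^ n.*2
  <= 3 ^ n * 2 ^ (n * n).
Proof.
move=> ne.
pose R := finset.setX (~: [set i0; i]) [set: 'I_n].
have cardR : #|R| + n.*2 = n * n.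
  have := cardsC [set i0; i]; rewrite cards2 eq_sym ne card_ord => h.
  by rewrite cardsX cardsT card_ord -mul2n -mulnDl addnC h.
rewrite -cardR expnD mulnA leq_mul2r -card_powerset; apply/orP; right.
pose row G : {ffun 'I_n -> 'I_3} :=
  [ffun j => if (i0, j) \in G then inord 0
             else if (i, j) \in G then inord 1 else inord 2].
set D := disjoint_rows i0 i.
have inj : {in D &, injective (fun G => (row G, G :&: R))}.
  move=> G H; rewrite !inE => /forallP HG /forallP HH [/ffunP Erow /finset.setP ER].
  have E j : ((i0, j) \in G) = ((i0, j) \in H) /\ ((i, j) \in G) = ((i, j) \in H).
    have := Erow j; rewrite !ffunE => /(congr1 val).
    move: (HG j) (HH j).
    by do 4 case: (_ \in _); rewrite /= !inordK.
  apply/finset.setP => -[k j].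
  have [->|nk0] := eqVneq k i0; first exact: (E j).1.
  have [->|nk] := eqVneq k i; first exact: (E j).2.
  by have := ER (k, j); rewrite !inE /= (negPf nk) (negPf nk0) /= !andbT.
rewrite -(card_in_imset inj).
apply: (@leq_trans #|finset.setX [set: {ffun 'I_n -> 'I_3}] (powerset R)|).
  apply/subset_leq_card/fintype.subsetP => _ /imsetP[G _ ->].
  by rewrite !inE /= finset.subsetIr.
by rewrite cardsX cardsT card_ffun !card_ord.
Qed.

End Counting.

Lemma bin_le_exp n m : 'C(n, m) <= n ^ m.
Proof.
apply: (@leq_trans (n ^_ m)); first by rewrite -bin_ffact leq_pmulr ?fact_gt0.
elim: m n => // m IH n; rewrite ffactnS expnS leq_mul2l; apply/orP; right.
apply: leq_trans (IH _) _; case: m {IH} => // m.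
by rewrite leq_exp2r ?leq_pred.
Qed.

Lemma bin_le_pow2 n m : 'C(n, m) <= 2 ^ n.
Proof.
rewrite -[n in 'C(n, m)]card_ord -[n in 2 ^ n]card_ord -cardsT -card_powerset.
rewrite cardsT -card_draws powersetT cardsT; exact: max_card.
Qed.

Lemma pow2_ge_from (F : nat -> nat) b0 :
  F b0 <= 2 ^ b0 -> (forall b, b0 <= b -> F b.+1 <= 2 * F b) ->
  forall b, b0 <= b -> F b <= 2 ^ b.
Proof.
move=> H0 HS b le; rewrite -(subnK le); elim: (b - b0) => // k IH.
rewrite addSn [2 ^ _]expnS; apply: leq_trans (HS _ (leq_addl _ _)) _.
by rewrite leq_mul2l.
Qed.

Lemma sqr_le_pow2 b : 16 <= b -> 32 * b ^ 2 <= 2 ^ b.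
Proof.
apply: (pow2_ge_from (F := fun b => 32 * b ^ 2)).
  by rewrite -[16]/(2 ^ 4) -[32]/(2 ^ 5) -expnM -expnD leq_exp2l.
by move=> {}b le; nia.
Qed.

Lemma quartic_le_pow2 n : 2 ^ 10 <= n -> n ^ 4 <= 2 ^ (n %/ 8).
Proof.
move=> le; set t := n %/ 8.
have le7 : 2 ^ 7 <= t by rewrite /t leq_divRL // -[8]/(2 ^ 3) -expnD.
have len : n <= 2 ^ 4 * t.
  have t_gt0 : 0 < t by apply: leq_trans le7; rewrite expn_gt0.
  have := divn_eq n 8; have := ltn_pmod n (isT : 0 < 8).
  by rewrite -/t -[2 ^ 4]/16; lia.
apply: (@leq_trans (2 ^ 16 * t ^ 4)).
  by rewrite -[16]/(4 * 4) expnM -expnMn leq_exp2r.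
move: le7; apply: (pow2_ge_from (F := fun t => 2 ^ 16 * t ^ 4)).
  by rewrite -expnM -expnD leq_exp2l.
move=> s le7; rewrite mulnCA leq_mul2l; apply/orP; right.
have {le7} : 2 ^ 3 <= s by apply: leq_trans le7; rewrite leq_exp2l.
rewrite -[2 ^ 3]/8 => le8.
have -> : s.+1 ^ 4 = s ^ 4 + (4 * s ^ 3 + 6 * s ^ 2 + 4 * s + 1) by ring.
have -> : 2 * s ^ 4 = s ^ 4 + s * s ^ 3 by ring.
rewrite leq_add2l.
have h3 : 8 * s ^ 3 <= s * s ^ 3 by rewrite leq_mul2r le8 orbT.
have h2 : 8 * s ^ 2 <= s ^ 3 by rewrite [s ^ 3]expnS leq_mul2r le8 orbT.
have h1 : 8 * s <= s ^ 2 by rewrite -mulnn leq_mul2r le8 orbT.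
by lia.
Qed.

Lemma card_bigcup_le (I T : finType) (P : pred I) (F : I -> {set T}) :
  #|\bigcup_(i | P i) F i| <= \sum_(i | P i) #|F i|.
Proof.
apply: (big_ind2 (fun (A : {set T}) m => #|A| <= m)) => [|A m B k HA HB|//].
  by rewrite cards0.
by apply: leq_trans (leq_card_setU _ _) (leq_add _ _).
Qed.

(** If [b >= n / 2], every non-fixed point of the two maps costs a factor of at
    most [n ^ 2] and there are at most twice as many of them as the [n - a] of
    the first map, while each of these gains [2 ^ b]. If [b < n / 2], then
    [n - a > n / 2], so the binomial coefficients cost at most [4 ^ (n - a)]
    each, and [b ^ 2 * 2 ^ 5 <= 2 ^ b] suffices: this is where enough seeds are
    needed to have [b >= 16]. *)
Lemma pair_count_bound n a b :
  2 ^ 10 <= n -> 16 <= a -> a <= b -> b <= n -> a < n ->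
  #|idempotents n a| * #|idempotents n b| * 2 ^ (n %/ 4) <= 2 ^ ((n - a) * b).
Proof.
move=> le10 le16 leab lebn ltan.
have n_gt0 : 0 < n by apply: leq_trans le10; rewrite expn_gt0.
have b_gt0 : 0 < b by lia.
set x := n - a; set y := n - b.
have x_gt0 : 0 < x by rewrite subn_gt0.
have lexy : y <= x by rewrite leq_sub2l.
apply: leq_trans (leq_mul (leq_mul (card_idempotents n a) (card_idempotents n b))
                          (leqnn _)) _.
rewrite -/x -/y mulnC [x * b]mulnC expnM.
have [ge|lt] := leqP n b.*2.
  have Ha : 'C(n, a) * a ^ x <= (n * n) ^ x.
    rewrite expnMn -(bin_sub (ltnW ltan)) -/x leq_mul ?bin_le_exp //.
    by rewrite leq_exp2r // ltnW.
  have Hb : 'C(n, b) * b ^ y <= (n * n) ^ x.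
    apply: (@leq_trans ((n * n) ^ y)); last by rewrite leq_pexp2l // muln_gt0 n_gt0.
    rewrite expnMn -(bin_sub lebn) -/y leq_mul ?bin_le_exp //.
    by case: (posnP y) => [->|y0] //; rewrite leq_exp2r.
  apply: (@leq_trans ((2 ^ (n %/ 4) * (n ^ 4)) ^ x)).
    rewrite expnMn leq_mul //.
      by rewrite -expnM leq_exp2l // leq_pmulr.
    have -> : n ^ 4 = (n * n) * (n * n) by rewrite !expnS expn0 muln1 !mulnA.
    by rewrite [X in _ <= X]expnMn leq_mul.
  rewrite leq_exp2r //.
  apply: (@leq_trans (2 ^ (n %/ 4) * 2 ^ (n %/ 8))).
    by rewrite leq_mul2l quartic_le_pow2 ?orbT.
  by rewrite -expnD leq_exp2l //; lia.
have Ha : 'C(n, a) * a ^ x <= 4 ^ x * b ^ x.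
  rewrite leq_mul ?leq_exp2r //; apply: leq_trans (bin_le_pow2 _ _) _.
  by rewrite -[4]/(2 ^ 2) -expnM leq_exp2l //; lia.
have Hb : 'C(n, b) * b ^ y <= 4 ^ x * b ^ x.
  rewrite leq_mul ?leq_pexp2l //; apply: leq_trans (bin_le_pow2 _ _) _.
  by rewrite -[4]/(2 ^ 2) -expnM leq_exp2l //; lia.
have Hm : 2 ^ (n %/ 4) <= 2 ^ x by rewrite leq_exp2l //; lia.
apply: leq_trans (leq_mul Hm (leq_mul Ha Hb)) _.
rewrite -!expnMn leq_exp2r //; apply: leq_trans (sqr_le_pow2 _); last by lia.
by nia.
Qed.

Section Cover.
Variables (n K : nat).
Hypotheses (n_large : 2 ^ 10 <= n) (K_le_n : K <= n) (K_ge16 : 16 <= K).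

(** The pairs of maps to representatives with the coarser partition on the
    rows. *)
Definition coarse_pairs : {set {ffun 'I_n -> 'I_n} * {ffun 'I_n -> 'I_n}} :=
  [set p | [&& idempotent p.1, idempotent p.2, K <= #|fixed p.1|,
               #|fixed p.1| <= #|fixed p.2| & #|fixed p.1| < n]].

Definition coarsely_regular : {set {set 'I_n * 'I_n}} :=
  \bigcup_(p in coarse_pairs) row_regular p.1 p.2.

Lemma card_coarsely_regular :
  #|coarsely_regular| * 2 ^ (n %/ 4) <= n.+1 ^ 2 * 2 ^ (n * n).
Proof.
pose size_fixed p : 'I_n.+1 * 'I_n.+1 :=
  (inord #|fixed (p : {ffun 'I_n -> 'I_n} * {ffun 'I_n -> 'I_n}).1|,
   inord #|fixed p.2|).
have cardle (f : {ffun 'I_n -> 'I_n}) : #|fixed f| < n.+1.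
  by rewrite ltnS -[X in _ <= X]card_ord max_card.
apply: leq_trans (leq_mul (card_bigcup_le _ _) (leqnn _)) _.
rewrite (partition_big size_fixed predT) //= big_distrl /=.
have -> : n.+1 ^ 2 * 2 ^ (n * n) = \sum_(c : 'I_n.+1 * 'I_n.+1) 2 ^ (n * n).
  by rewrite sum_nat_const card_prod card_ord.
apply: leq_sum => -[a b] _.
have [p0 Hp0|none] := pickP [pred p | (p \in coarse_pairs) && (size_fixed p == (a, b))];
  last by rewrite big_pred0.
have Hab p : size_fixed p == (a, b) -> #|fixed p.1| = a /\ #|fixed p.2| = b.
  by move=> /eqP[<- <-]; rewrite !inordK.
move: Hp0 => /= /andP[]; rewrite inE => /and5P[_ _ HK Hle Hlt] /Hab[Ea Eb].
rewrite Ea Eb in HK Hle Hlt.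
have lebn : b <= n by rewrite -ltnS.
have Hbound := pair_count_bound n_large (leq_trans K_ge16 HK) Hle lebn Hlt.
rewrite -(@leq_pmul2r (2 ^ ((n - a) * b))) ?expn_gt0 //.
set s := \sum_(p | _) _.
have Hs : s * 2 ^ ((n - a) * b)
    <= #|idempotents n a| * #|idempotents n b| * 2 ^ (n * n).
  rewrite big_distrl /= -cardsX -sum_nat_const.
  rewrite [X in X <= _](eq_bigl (fun p => (p \in finset.setX (idempotents n a) (idempotents n b))
     && ((p \in coarse_pairs) && (size_fixed p == (a, b))))); last first.
    move=> p /=; rewrite andbC; case: (boolP (_ && _)) => [/andP[/Hab[E1 E2]]|]; last by rewrite andbF.
    by rewrite !inE E1 E2 !eqxx => /and5P[-> -> _ _ _].
  rewrite big_mkcondr /=; apply: leq_sum => p _; case: ifP => // /andP[].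
  rewrite inE => /and5P[id1 id2 _ _ _] /Hab[E1 E2].
  have := card_row_regular id1 id2.
  by rewrite [#|~: _|]cardsCs finset.setCK card_ord E1 E2.
rewrite mulnAC; apply: leq_trans (leq_mul Hs (leqnn _)) _.
by rewrite mulnAC mulnC leq_mul2l Hbound orbT.
Qed.

Definition transpose (G : {set 'I_n * 'I_n}) : {set 'I_n * 'I_n} :=
  [set p | (p.2, p.1) \in G].

Lemma transpose_inj : injective transpose.
Proof.
move=> G H /finset.setP E; apply/finset.setP => -[i j].
by have := E (j, i); rewrite !inE.
Qed.

Lemma representatives (k : 'I_n -> nat) :
  exists f : {ffun 'I_n -> 'I_n},
    (forall i, f (f i) = f i) /\ forall i j, (f i == f j) = (k i == k j).
Proof.
pose r i := odflt i [pick j | k j == k i].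
have kr i : k (r i) = k i.
  by rewrite /r; case: pickP => [j /eqP|].
have r_eq i j : k i = k j -> r i = r j.
  move=> E; rewrite /r (eq_pick (Q := fun l => k l == k j)); last first.
    by move=> l; rewrite E.
  by case: pickP => // /(_ j); rewrite eqxx.
exists [ffun i => r i]; split=> [i|i j]; rewrite !ffunE; first exact/r_eq/kr.
by apply/eqP/eqP => [E|/r_eq //]; rewrite -(kr i) E kr.
Qed.

Lemma card_fixed_ge (f : {ffun 'I_n -> 'I_n}) :
  (forall i, val i < K -> f i = i) -> K <= #|fixed f|.
Proof.
move=> H; rewrite -[X in X <= _]card_ord.
have w_inj : injective (widen_ord K_le_n).
  by move=> i j /(congr1 val) /= E; apply: val_inj.
rewrite -(card_imset predT w_inj).
apply/subset_leq_card/fintype.subsetP => _ /imsetP[i _ ->].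
by rewrite inE H /=.
Qed.

Variable G : bigraph n.
Variable i0 : 'I_n.
Hypothesis i0_seed : val i0 < K.

(** Suppose that rows [i0] and [i] meet in a column [l]. As [inl i] and [inr j]
    have the same colour, [inr j] has a neighbour [inl i'] with the colour of
    [inr l]. Since [inr l] is adjacent to the seed [inl i0], so is [inl i'],
    but no edge lies within a class. *)
Lemma mixed_class_disjoint_rows k i j :
  equitable G k -> isolates K k -> k (inl i) = k (inr j) ->
  i != i0 /\ G \in disjoint_rows i0 i.
Proof.
move=> Heq Hiso E.
have seed0 : is_seed K (inl i0 : vertex n) by [].
have witness (x y z : vertex n) : k x = k y -> adj G x z ->
    exists2 t, adj G y t & k t = k z.
  move=> Exy Axz; have := Heq x y Exy z.
  rewrite (bigD1 z) //= Axz eqxx => Es.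
  have [t /andP[At /eqP kt]|none] := pickP [pred t | adj G y t && (k t == k z)].
    by exists t.
  by move: Es; rewrite [RHS]big1 // => t _; have /= -> := none t.
split.
  apply/eqP => Ei; rewrite Ei in E.
  by have := Hiso _ _ seed0 E.
rewrite inE; apply/forallP => l; apply/negP => /andP[H0 Hi].
have [t Ajt Et] := witness _ _ (inr l) E Hi.
case: t Ajt Et => [i'|//] Ajt Et.
have [t' At' Et'] := witness (inr l) (inl i') (inl i0) (esym Et) H0.
by have Ht := Hiso _ _ seed0 (esym Et'); rewrite -Ht in At'.
Qed.

(** Within each class, choose representatives of the colours. If both choices
    are trivial, the colouring can only fail to be injective across the
    classes. Otherwise the class with fewer colours takes the part of the rows,
    after a transposition if it is the second one. *)
Lemma not_identifiable_cover :
  ~ identifiable K G ->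
  [\/ exists2 i, i != i0 & G \in disjoint_rows i0 i,
      (G : {set _}) \in coarsely_regular
    | transpose G \in coarsely_regular].
Proof.
move=> nid.
have [k [Heq Hiso ninj]] : exists k, [/\ equitable G k, isolates K k & ~ injective k].
  apply: contrapT => none; apply: nid => k Heq Hiso.
  by apply: contrapT => ninj; apply: none; exists k.
have [[i [j E]]|unmixed] := pselect (exists i j, k (inl i) = k (inr j)).
  have [ne Hd] := mixed_class_disjoint_rows Heq Hiso E.
  by apply: Or31; exists i.
have [f [ff fk]] := representatives (fun i => k (inl i)).
have [g [gg gk]] := representatives (fun j => k (inr j)).
have idf : idempotent f by apply/forallP => i; rewrite ff.
have idg : idempotent g by apply/forallP => i; rewrite gg.
have regular_fg : (G : {set _}) \in row_regular f g.
  rewrite inE; apply/forallP => i; apply/forallP => j.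
  rewrite inE; apply/implyP => /eqP gj.
  have E : k (inl i) = k (inl (f i)) by apply/eqP; rewrite -fk ff.
  have := Heq _ _ E (inr j); rewrite !big_sumType /= !big1_eq !add0n => Es.
  apply/eqP; move: Es; rewrite /row_degree !(big_mkcond (fun l => g l == j)) /=.
  have T i1 l : nat_of_bool (((i1, l) \in (G : {set _})) && (k (inr l) == k (inr j)))
      = if g l == j then nat_of_bool ((i1, l) \in (G : {set _})) else 0.
    by rewrite -{2}gj gk; case: (_ \in _); case: eqP.
  by under eq_bigr do rewrite T; under [in RHS]eq_bigr do rewrite T.
have regular_gf : transpose G \in row_regular g f.
  rewrite inE; apply/forallP => j; apply/forallP => i.
  rewrite inE; apply/implyP => /eqP fi.
  have E : k (inr j) = k (inr (g j)) by apply/eqP; rewrite -gk gg.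
  have := Heq _ _ E (inl i); rewrite !big_sumType /= !big1_eq !addn0 => Es.
  apply/eqP; move: Es; rewrite /row_degree !(big_mkcond (fun l => f l == i)) /=.
  have T j1 l : nat_of_bool (((l, j1) \in (G : {set _})) && (k (inl l) == k (inl i)))
      = if f l == i then nat_of_bool ((j1, l) \in transpose G) else 0.
    by rewrite inE /= -{2}fi fk; case: (_ \in _); case: eqP.
  by under eq_bigr do rewrite T; under [in RHS]eq_bigr do rewrite T.
have Kf : K <= #|fixed f|.
  apply: card_fixed_ge => i lt; have /eqP : f (f i) == f i by rewrite ff.
  move/eqP; rewrite fk eq_sym => /eqP E.
  by have [] := Hiso (inl i) (inl (f i)) lt E.
have Kg : K <= #|fixed g|.
  apply: card_fixed_ge => i lt; have /eqP : g (g i) == g i by rewrite gg.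
  move/eqP; rewrite gk eq_sym => /eqP E.
  by have [] := Hiso (inr i) (inr (g i)) lt E.
have full (h : {ffun 'I_n -> 'I_n}) : n <= #|fixed h| -> forall i, h i = i.
  move=> le i; have /eqP : fixed h == [set: 'I_n].
    by rewrite eqEcard finset.subsetT cardsT card_ord.
  by move/finset.setP/(_ i); rewrite !inE => /eqP.
have not_full : ~~ ((n <= #|fixed f|) && (n <= #|fixed g|)).
  apply/negP => /andP[/full f1 /full g1]; apply: ninj => -[i|i] [j|j] E.
  - by congr inl; apply/eqP; rewrite -[i]f1 -[j]f1 fk E.
  - by case: unmixed; exists i, j.
  - by case: unmixed; exists j, i.
  - by congr inr; apply/eqP; rewrite -[i]g1 -[j]g1 gk E.
have [le|lt] := leqP #|fixed f| #|fixed g|.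
  apply: Or32; apply/bigcupP; exists (f, g) => //.
  rewrite inE idf idg Kf le /= ltnNge; apply: contra not_full => lef.
  by rewrite lef (leq_trans lef).
apply: Or33; apply/bigcupP; exists (g, f) => //.
rewrite inE idf idg Kg (ltnW lt) /= ltnNge; apply: contra not_full => leg.
by rewrite leg (leq_trans leg) // ltnW.
Qed.
End Cover.

Lemma identifiable_all_seeds n K (G : bigraph n) : n <= K -> identifiable K G.
Proof.
move=> le k _ Hiso x y; apply: Hiso.
by case: x => i; apply: leq_trans le => /=.
Qed.

Lemma pow3_le n : 3 ^ n * 2 ^ (n %/ 4) <= 2 ^ n.*2.
Proof.
set q := n %/ 4; set r := n %% 4.
have En : n = 4 * q + r by rewrite mulnC -divn_eq.
have -> : 3 ^ n * 2 ^ q = (3 ^ 4 * 2) ^ q * 3 ^ r.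
  by rewrite {1}En expnD expnM expnMn mulnAC.
have -> : 2 ^ n.*2 = (2 ^ 8) ^ q * (2 ^ 2) ^ r.
  by rewrite -!expnM -expnD; congr (2 ^ _); lia.
by rewrite leq_mul //; [case: q {En}|case: r {En}] => // k; rewrite leq_exp2r.
Qed.

(** The factor [2 ^ (n %/ 4)] gained by every term of the union bound pays both
    for the fewer than [n ^ 4 <= 2 ^ (n %/ 8)] terms and for the final
    [2 ^ (n %/ 8)]. *)
Lemma card_not_identifiable n K :
  2 ^ 10 <= n -> K <= n -> 16 <= K ->
  #|[set G : bigraph n | `[< ~ identifiable K G >]]| * 2 ^ (n %/ 8)
  <= 2 ^ (n ^ 2).
Proof.
move=> n_large K_le_n K_ge16.
have n16 : 16 <= n by apply: leq_trans n_large; rewrite -[16]/(2 ^ 4) leq_exp2l.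
have n_gt0 : 0 < n by lia.
set B := [set G | _]; set T := coarsely_regular n K.
pose i0 : 'I_n := Ordinal n_gt0.
pose T' := [set G : {set 'I_n * 'I_n} | transpose G \in T].
pose D := \bigcup_(i | i != i0) disjoint_rows i0 i.
have cover : #|B| <= #|D| + #|T| + #|T'|.
  apply: (@leq_trans #|D :|: T :|: T'|).
    apply/subset_leq_card/fintype.subsetP => G; rewrite inE => /asboolP.
    have i0_seed : val i0 < K by apply: leq_trans K_ge16.
    case/(not_identifiable_cover K_le_n i0_seed) => [[i ne HG]|HG|HG].
    - rewrite !inE; apply/orP; left; apply/orP; left.
      by apply/bigcupP; exists i.
    - by rewrite !inE -/T HG orbT.
    - by rewrite !inE -/T HG !orbT.
  apply: leq_trans (leq_card_setU _ _) _; rewrite leq_add2r.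
  exact: (leq_card_setU _ _).
have leT' : #|T'| <= #|T|.
  rewrite -(card_imset [in T'] (@transpose_inj n)); apply/subset_leq_card.
  by apply/fintype.subsetP => _ /imsetP[G + ->]; rewrite inE.
have leT := card_coarsely_regular n_large K_ge16.
have leD : #|D| * 2 ^ (n %/ 4) <= n * 2 ^ (n * n).
  apply: leq_trans (leq_mul (card_bigcup_le _ _) (leqnn _)) _.
  have -> : n * 2 ^ (n * n) = \sum_(i < n) 2 ^ (n * n).
    by rewrite sum_nat_const card_ord.
  rewrite big_distrl /=.
  rewrite [X in _ <= X](bigID (fun i => i != i0)) /=.
  apply: leq_trans (leq_addr _ _); apply: leq_sum => i ne.
  rewrite -(@leq_pmul2r (2 ^ n.*2)) ?expn_gt0 // mulnAC.
  apply: leq_trans (leq_mul (card_disjoint_rows ne) (leqnn _)) _.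
  by rewrite mulnAC mulnC leq_mul2l pow3_le orbT.
have total : #|B| * 2 ^ (n %/ 4) <= n ^ 4 * 2 ^ (n * n).
  apply: leq_trans (leq_mul cover (leqnn _)) _.
  apply: (@leq_trans ((n + 2 * n.+1 ^ 2) * 2 ^ (n * n))).
    have := leq_mul leT' (leqnn (2 ^ (n %/ 4))); rewrite -/T in leT; lia.
  rewrite leq_mul2r; apply/orP; right.
  have -> : n ^ 4 = n * n * (n * n) by ring.
  by nia.
rewrite -mulnn -(@leq_pmul2r (2 ^ (n %/ 8))) ?expn_gt0 //.
apply: (@leq_trans (#|B| * 2 ^ (n %/ 4))).
  by rewrite -mulnA -expnD leq_mul2l leq_exp2l //; apply/orP; right; lia.
apply: leq_trans total _.
by rewrite mulnC leq_mul2l quartic_le_pow2 ?orbT.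
Qed.

(** * The theorem *)

(** The number of seeds in each class is also the size from which the counting
    bound applies; smaller graphs consist of seeds only. *)
Definition seed_pairs : nat := 2 ^ 10.

Definition gi_program : program := ram (gi_test seed_pairs) 4.

Lemma gi_program_polynomial_time : polynomial_time gi_program.
Proof. exact/ram_polynomial_time/gi_test_closed. Qed.

(** On empty graphs the loops run no round and the program answers no, wrongly;
    the bound of the theorem allows this, as its right-hand side is 2. *)
Definition exceptional n : {set bigraph n} :=
  if n == 0 then [set: bigraph n]
  else [set G | `[< ~ identifiable seed_pairs G >]].

Lemma gi_program_correct n (G G' : bigraph n) :
  G \notin exceptional n -> correct_on gi_program G G'.
Proof.
rewrite /exceptional; case: posnP => [_|n_gt0]; first by rewrite inE.
rewrite inE => /asboolPn/contrapT Hid.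
apply: ram_answers; first exact: gi_test_closed.
have [sound complete] := gi_testP seed_pairs G G' n_gt0.
by apply/idP/idP => [/sound|/complete->].
Qed.

Local Open Scope ring_scope.

Lemma expR_sqrt_le (R : realType) (n : nat) :
  (2 ^ 10 <= n)%N -> expR (n%:R `^ 2^-1) <= 2 ^+ (n %/ 8) :> R.
Proof.
move=> n_large; set h := (n %/ 8)%N.
have half : expR (2^-1) <= 2 :> R.
  have := @expR_ge1Dx R (- 2^-1); rewrite expRN.
  rewrite -[X in _ <= X -> _]div1r ler_pdivlMr ?expR_gt0 // => H.
  have : expR 2^-1 = 2 * ((1 + - 2^-1) * expR 2^-1) :> R by field.
  by move=> ->; rewrite ler_piMr.
have sqrt_le : n%:R `^ 2^-1 <= h%:R * 2^-1 :> R.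
  rewrite powR12_sqrt // -(@ler_pXn2r _ 2) ?nnegrE ?sqrtr_ge0 ?mulr_ge0 //.
  rewrite sqr_sqrtr // exprMn -natrX exprVn -natrX ler_pdivlMr ?ltr0n //.
  rewrite -natrM ler_nat -[(2 ^ 2)%N]/4%N.
  have le7 : (2 ^ 7 <= h)%N by rewrite /h leq_divRL // -[8%N]/(2 ^ 3)%N -expnD.
  have := divn_eq n 8; have := ltn_pmod n (isT : (0 < 8)%N); rewrite -/h => lt8 En.
  apply: (@leq_trans (2 ^ 7 * h)); last by rewrite -mulnn leq_mul2r le7 orbT.
  by rewrite -[(2 ^ 7)%N]/128%N in le7 *; lia.
apply: le_trans (_ : expR (h%:R * 2^-1) <= _); first by rewrite ler_expR.
by rewrite expRM_natl lerXn2r ?nnegrE ?expR_ge0.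
Qed.

Lemma card_exceptional (R : realType) n :
  #|exceptional n|%:R <= 2 * expR (- (n%:R `^ 2^-1)) * 2 ^+ (n ^ 2)%N :> R.
Proof.
rewrite /exceptional; case: posnP => [->|n_gt0].
  rewrite cardsT card_bigraph powR0 ?invr_eq0 // oppr0 expR0 mulr1.
  by rewrite exp0n // expn0 expr0 mulr1 ler1n.
have rhs_ge0 : 0 <= expR (- (n%:R `^ 2^-1)) * 2 ^+ (n ^ 2)%N :> R.
  by rewrite mulr_ge0 ?expR_ge0 ?exprn_ge0.
have [lt|ge] := ltnP n (2 ^ 10)%N.
  rewrite (_ : [set G | _] = finset.set0) ?cards0 -?mulrA ?mulr_ge0 //.
  apply/finset.setP => G; rewrite !inE; apply/asboolPn => H; apply: H.
  exact/identifiable_all_seeds/ltnW.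
have le16 : (16 <= 2 ^ 10)%N by rewrite -[16%N]/(2 ^ 4)%N leq_exp2l.
have Hc := card_not_identifiable ge ge le16.
rewrite -mulrA; apply: le_trans (ler_peMl rhs_ge0 _); last by rewrite ler1n.
rewrite expRN mulrC ler_pdivlMr ?expR_gt0 //.
apply: le_trans (ler_wpM2l _ (expR_sqrt_le R ge)) _ => //.
by rewrite -!natrX -natrM ler_nat.
Qed.

Lemma uniform_pr_correct (R : realType) n :
  1 - 2 * expR (- (n%:R `^ 2^-1)) <=
  uniform_pr R [pred GG : bigraph n * bigraph n
                  | `[< correct_on gi_program GG.1 GG.2 >] ].
Proof.
rewrite /uniform_pr; set E := [pred GG | _].
have cardT : #|bigraph n|%:R = 2 ^+ (n ^ 2)%N :> R by rewrite card_bigraph natrX.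
have T_gt0 : 0 < 2 ^+ (n ^ 2)%N :> R by rewrite exprn_gt0.
rewrite card_prod natrM cardT ler_pdivlMr ?mulr_gt0 //.
have sub : ((#|bigraph n| - #|exceptional n|) * #|bigraph n| <= #|E|)%N.
  have -> : (#|bigraph n| - #|exceptional n|)%N = #|~: exceptional n|.
    by rewrite [RHS]cardsCs finset.setCK.
  rewrite -[X in (_ * X)%N]cardsT -cardsX; apply/subset_leq_card/fintype.subsetP => -[G G'].
  rewrite !inE /= andbT => HG; exact: gi_program_correct.
have := card_exceptional R n; set e := expR _ => He.
apply: le_trans (_ : ((#|bigraph n| - #|exceptional n|) * #|bigraph n|)%:R <= _);
  last by rewrite ler_nat.
rewrite natrM natrB ?max_card // cardT mulrA ler_wpM2r ?exprn_ge0 //.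
by rewrite mulrBl mul1r lerB.
Qed.

Theorem corollary1p9 (R : realType) :
  exists c : R, 0 < c /\
    (exists P : program, polynomial_time P /\
       forall n : nat, exists B : {set bigraph n},
         #|B|%:R <= 2 * expR (- (n%:R `^ c)) * 2 ^+ (n ^ 2)%N /\
         forall G G' : bigraph n,
           G \notin B -> G' \notin B -> correct_on P G G') /\
    (exists P : program, polynomial_time P /\
       forall n : nat,
         1 - 2 * expR (- (n%:R `^ c)) <=
         uniform_pr R [pred GG : bigraph n * bigraph n
                         | `[< correct_on P GG.1 GG.2 >] ]).
Proof.
exists 2^-1; split; first by rewrite invr_gt0.
split; exists gi_program; split; try exact: gi_program_polynomial_time.
  move=> n; exists (exceptional n); split; first exact: card_exceptional.
  by move=> G G' HG _; apply: gi_program_correct.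
by move=> n; apply: uniform_pr_correct.
Qed.
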